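(* Let $M$ be a compact manifold with non-empty boundary $\partial M$ (equipped with a metric $d$), let $E\subset M$ be a boundary retract of $M$ (with a fixed associated map $\Psi$ and retraction $R$), let $I$ be a compact metric space, and let $\{f_t\}_{t\in I}$ be a continuous family in $\mathcal{C}(E,E)$ which unwraps in $M$. Suppose moreover that there is some integer $m>0$ such that every $f_t$ stabilizes at iterate $m$, i.e. $f_t^{m+1}(E)=f_t^m(E)$ for all $t\in I$. Then for each $\epsilon>0$ there is a continuous family $\{\Phi_t\}_{t\in I}$ in $\mathcal{H}(M,M)$ such that: (a) For each $t\in I$ there is a compact $\Phi_t$-invariant subset $\Lambda_t$ of $M$ with the following properties: (i) $\Phi_t|_{\Lambda_t}\colon\Lambda_t\to\Lambda_t$ is topologically conjugate to the natural extension $\hat f_t\colon\varprojlim(E,f_t)\to\varprojlim(E,f_t)$. (ii) If $x\in M-\partial M$, then the $\omega$-limit set $\omega(x,\Phi_t)$ is contained in $\Lambda_t$. (iii) There is some integer $k>0$ (which may depend on $t$) such that $\Phi_t^k$ is the identity on $\partial M$. (b) There is a continuous family $\{g_t\}_{t\in I}$ in $\mathcal{C}(M,M)$ such that, for all $t\in I$, $d(g_t,\mathrm{id})<\epsilon$, $g_t(\Lambda_t)=f_t^m(E)$, and $f_t\circ g_t|_{\Lambda_t}=g_t\circ\Phi_t|_{\Lambda_t}$. (c) For each $t\in I$, the semiconjugacy $g_t$ restricts to a bijection from the set of periodic points of $\Phi_t$ in $\Lambda_t$ to the set of periodic points of $f_t$. (d) The sets $\Lambda_t$ vary continuously with $t\in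 I$ in the Hausdorff metric on compact subsets of $M$.
   Context: Spaces of maps. For compact metric spaces $X,Y$, $\mathcal{C}(X,Y)$ and $\mathcal{H}(X,Y)$ denote the spaces of continuous maps and of homeomorphisms $X\to Y$, with the uniform metric $d(f,g)=\sup_{x\in X} d(f(x),g(x))$. A family $\{f_t\}_{t\in I}$ in $\mathcal{C}(X,Y)$ (or $\mathcal{H}(X,Y)$) is continuous if $t\mapsto f_t$ is continuous for the uniform metric (equivalently, $(x,t)\mapsto f_t(x)$ is continuous). $\mathbb{N}$ includes $0$. Inverse limits. For a continuous map $f\colon X\to X$ of a compact metric space, $\varprojlim(X,f)=\{\underline{x}=(x_0,x_1,\dots)\in X^{\mathbb{N}} : f(x_{i+1})=x_i \text{ for all } i\in\mathbb{N}\}$, as a subspace of the product $X^{\mathbb{N}}$. The natural extension of $f$ is the homeomorphism $\hat f\colon\varprojlim(X,f)\to\varprojlim(X,f)$, $\hat f(\underline{x})=(f(x_0),x_0,x_1,\dots)$. Boundary retract. Let $M$ be a compact manifold with non-empty boundary $\partial M$. A subset $E\subset M$ is a boundary retract of $M$ if there is a continuous map $\Psi\colon\partial M\times[0,1]\to M$ such that (1) $\Psi$ restricted to $\partial M\times[0,1)$ is a homeomorphism onto $M-E$; (2) $\Psi(\eta,0)=\eta$ for all $\eta\in\partial M$; (3) $\Psi(\partial M\times\{1\})=E$. The associated retraction $R\colon M\to E$ is defined by $R(\Psi(\eta,s))=\Psi(\eta,1)$. Unwrapping. Let $E$ be a boundary retract of $M$ with associated retraction $R$. A continuous map $f\colon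 E\to E$ unwraps in $M$ if there is a homeomorphism $\overline{f}\colon M\to M$ such that (1) $R\circ\overline{f}|_E=f$, and (2) there is some $k>0$ such that $\overline{f}^k$ is the identity on $\partial M$. Such an $\overline{f}$ is called an unwrapping of $f$. A continuous family $\{f_t\}_{t\in I}$ in $\mathcal{C}(E,E)$ unwraps in $M$ if there is a continuous family $\{\overline{f}_t\}_{t\in I}$ in $\mathcal{H}(M,M)$ such that each $\overline{f}_t$ is an unwrapping of $f_t$. Stabilization. $f\in\mathcal{C}(X,X)$ stabilizes at iterate $m$ if $f^{m+1}(X)=f^m(X)$ ($m$ need not be the least such integer). *)

(* Defs.v *)
From HB Require Import structures.
From mathcomp Require Import all_boot all_order all_algebra.
From mathcomp Require Import all_classical all_reals all_analysis.

Set Implicit Arguments.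
Unset Strict Implicit.
Unset Printing Implicit Defensive.

Import Order.TTheory GRing.Theory Num.Theory.
Import numFieldNormedType.Exports.

Local Open Scope classical_set_scope.
Local Open Scope ring_scope.

(* Maps between subsets are represented by functions on the ambient types, of
   which only the values on the domain [A] matter; [A] and [B] carry the
   subspace topologies. *)

Definition continuous_map {X Y : topologicalType} (A : set X) (B : set Y)
    (f : X -> Y) : Prop :=
  {within A, continuous f} /\ set_fun A B f.

Definition homeomorphism {X Y : topologicalType} (A : set X) (B : set Y)
    (f : X -> Y) : Prop :=
  [/\ {within A, continuous f}, set_bij A B f &
      exists g : Y -> X,
        {within B, continuous g} /\ (forall x, A x -> g (f x) = x)].

(* Dimension is written [n.+1]: a 0-dimensional manifold has no boundary. *)

Definition half_space (R : realType) (n : nat) : set 'rV[R]_n.+1 :=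
  [set v | 0 <= v ord0 ord0].
Arguments half_space : clear implicits.

Definition chart_at (R : realType) (n : nat) {M : topologicalType} (p : M)
    (U : set M) (phi : M -> 'rV[R]_n.+1) : Prop :=
  open_nbhs p U /\
  exists W : set 'rV[R]_n.+1,
    open W /\ homeomorphism U (W `&` half_space R n) phi.

Definition manifold_with_boundary (R : realType) (n : nat)
    (M : topologicalType) : Prop :=
  [/\ hausdorff_space M, @second_countable M &
      forall p : M, exists (U : set M) (phi : M -> 'rV[R]_n.+1),
        chart_at p U phi].

Definition manifold_interior (R : realType) (n : nat)
    (M : topologicalType) : set M :=
  [set p | exists (U : set M) (W : set 'rV[R]_n.+1) (phi : M -> 'rV[R]_n.+1),
     [/\ open_nbhs p U, open W & homeomorphism U W phi]].
Arguments manifold_interior : clear implicits.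

(* By invariance of domain, these are the points that some half-space chart
   sends to the hyperplane bounding the half-space. *)
Definition manifold_boundary (R : realType) (n : nat)
    (M : topologicalType) : set M := ~` manifold_interior R n M.
Arguments manifold_boundary : clear implicits.

Definition uniform_dist (R : realType) {X : Type} {Y : metricType R}
    (A : set X) (f g : X -> Y) : \bar R :=
  ereal_sup [set (mdist (f x) (g x))%:E | x in A].

Definition parameter_continuous (R : realType)
    {I : topologicalType} {X : Type} {Y : metricType R}
    (A : set X) (F : I -> X -> Y) : Prop :=
  forall (t : I) (e : R), 0 < e ->
    \forall s \near t, (uniform_dist A (F s) (F t) < e%:E)%E.

Definition continuous_family_C (R : realType) {I : topologicalType}
    {X Y : metricType R} (A : set X) (B : set Y) (F : I -> X -> Y) : Prop :=
  (forall t, continuous_map A B (F t)) /\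
  parameter_continuous A F.

Definition continuous_family_H (R : realType) {I : topologicalType}
    {X Y : metricType R} (A : set X) (B : set Y) (F : I -> X -> Y) : Prop :=
  (forall t, homeomorphism A B (F t)) /\
  parameter_continuous A F.

(* [edist (x, y)] equals [(mdist x y)%:E], so [edist_inf B x] is the distance
   from the point [x] to the set [B]. *)
Definition hausdorff_dist (R : realType) {M : metricType R}
    (A B : set M) : \bar R :=
  Order.max (ereal_sup [set edist_inf B x | x in A])
            (ereal_sup [set edist_inf A x | x in B]).

Definition boundary_retract_map (R : realType) (n : nat) (M : metricType R)
    (E : set M) (Psi : M * R -> M) : Prop :=
  let bM := manifold_boundary R n M in
  [/\ continuous_map (bM `*` `[0, 1] : set (M * R)) [set: M] Psi,
      homeomorphism (bM `*` `[0, 1[ : set (M * R)) (~` E) Psi,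
      (forall eta, bM eta -> Psi (eta, 0) = eta) &
      Psi @` (bM `*` [set 1]) = E].

(* This determines [r] on all of [M], since [Psi] is onto. *)
Definition associated_retraction (R : realType) (n : nat) (M : metricType R)
    (Psi : M * R -> M) (r : M -> M) : Prop :=
  forall (eta : M) (s : R), manifold_boundary R n M eta -> 0 <= s <= 1 ->
    r (Psi (eta, s)) = Psi (eta, 1).

Definition periodic_on {X : Type} (B : set X) (F : X -> X) : Prop :=
  exists k : nat, (0 < k)%N /\ forall x, B x -> iter k F x = x.

Definition unwrapping (R : realType) (n : nat) (M : metricType R)
    (E : set M) (r : M -> M) (f fbar : M -> M) : Prop :=
  [/\ homeomorphism [set: M] [set: M] fbar,
      (forall x, E x -> r (fbar x) = f x) &
      periodic_on (manifold_boundary R n M) fbar].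

Definition family_unwraps (R : realType) (n : nat) (I : topologicalType)
    (M : metricType R) (E : set M) (r : M -> M) (f : I -> M -> M) : Prop :=
  exists fbar : I -> M -> M,
    continuous_family_H [set: M] [set: M] fbar /\
    forall t, unwrapping n E r (f t) (fbar t).

Definition stabilizes_at {X : Type} (E : set X) (f : X -> X) (m : nat) : Prop :=
  iter m.+1 f @` E = iter m f @` E.

Definition inverse_limit {X : topologicalType} (E : set X) (f : X -> X) :
    set {ptws nat -> X} :=
  [set x | forall i : nat, E (x i) /\ f (x i.+1) = x i].

Definition natural_extension {X : topologicalType} (f : X -> X)
    (x : {ptws nat -> X}) : {ptws nat -> X} :=
  fun i => if i is j.+1 then x j else f (x 0%N).

Definition conjugate_on {X Y : topologicalType} (A : set X) (f : X -> X)
    (B : set Y) (g : Y -> Y) : Prop :=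
  exists h : X -> Y,
    homeomorphism A B h /\ forall x, A x -> h (f x) = g (h x).

Definition omega_limit {X : topologicalType} (x : X) (F : X -> X) : set X :=
  cluster ((fun j : nat => iter j F x) @ \oo).

Definition periodic_points {X : Type} (A : set X) (f : X -> X) : set X :=
  [set x | A x /\ exists k : nat, (0 < k)%N /\ iter k f x = x].

(* Main.v *)
(** Write [H_t] for the unwrapping followed by a smash: a map of [M] that slides
    points along the collar lines [Psi (eta, -)] and crushes a neighbourhood of
    [E] onto [E]. On [E] it is [f_t], on the boundary it is the unwrapping, and
    if the smash is strong enough every interior point is driven into [E] in
    finitely many steps. Sliding a little less makes [H_t] a homeomorphism, so
    [H_t] is a uniform limit of homeomorphisms.

    By Brown's theorem the inverse limit of [(M, H_t)] is then [M] itself: for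
    homeomorphisms [F_1, F_2, ...] converging to [H] fast enough, the maps
    [g_i = lim_k H^k o (F_1 o ... o F_(i+k))^-1] satisfy [H o g_(i+1) = g_i],
    and [y |-> (g_0 y, g_1 y, ...)] is a bijection from [M] onto the backward
    orbits of [H]. Shifting backward orbits gives [Phi_t], the semiconjugacy is [g_0],
    and [Lambda_t] consists of the points whose backward orbit stays in [E].
    Choosing the [F_n] uniformly in [t] makes everything continuous in [t]. *)

Require Import Defs.
From HB Require Import structures.
From mathcomp Require Import all_boot all_order all_algebra.
From mathcomp Require Import all_classical all_reals all_analysis.
From mathcomp Require Import lra zify.

Set Implicit Arguments.
Unset Strict Implicit.
Unset Printing Implicit Defensive.

Import Order.TTheory GRing.Theory Num.Theory.
Import numFieldNormedType.Exports.

Local Open Scope classical_set_scope.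
Local Open Scope ring_scope.

(** * Closed graphs and compactness *)

(** A tube argument: if no point of [K] is related to [x], compactness gives a single neighbourhood
    of [x] over which [C] misses all of [K]. *)
Lemma closed_projection {X Z : topologicalType} (K : set Z) (C : set (X * Z)) :
  compact K -> closed C -> closed [set x | exists2 z, K z & C (x, z)].
Proof.
move=> /compact_near_coveringP cK cC; rewrite -openC openE => x /= nx.
have : \forall x' \near x, K `<=` [set z | ~ C (x', z)].
  apply: cK => z Kz.
  have : nbhs (x, z) (~` C).
    by apply: open_nbhs_nbhs; split; [rewrite openC|move=> Cxz; apply: nx; exists z].
  move=> [[A B] [/= nA nB] AB]; exists (B, A) => //= -[z' x'] [/= Bz' Ax'].
  exact: (AB (x', z')).
by apply: filterS => x' sub [z Kz Cz]; exact: sub Kz Cz.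
Qed.

Lemma closed_preimage {X Y : topologicalType} (f : X -> Y) (D : set Y) :
  continuous f -> closed D -> closed (f @^-1` D).
Proof. by move=> /continuous_closedP; apply. Qed.

Lemma continuous_pair {X Y Z : topologicalType} (f : X -> Y) (g : X -> Z) :
  continuous f -> continuous g -> continuous (fun x => (f x, g x)).
Proof. by move=> cf cg x; apply: cvg_pair; [exact: cf|exact: cg]. Qed.

Lemma fst_continuous {X Y : topologicalType} : continuous (@fst X Y).
Proof. by move=> p; exact: cvg_fst. Qed.

Lemma snd_continuous {X Y : topologicalType} : continuous (@snd X Y).
Proof. by move=> p; exact: cvg_snd. Qed.

Lemma continuous_compose {X Y Z : topologicalType} (f : X -> Y) (g : Y -> Z) :
  continuous f -> continuous g -> continuous (fun x => g (f x)).
Proof. by move=> cf cg x; exact: (continuous_comp (cf x) (cg (f x))). Qed.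

Lemma hausdorff_prod {X Y : topologicalType} :
  hausdorff_space X -> hausdorff_space Y -> hausdorff_space (X * Y)%type.
Proof.
move=> hX hY [x y] [x' y'] cl; congr pair.
  apply: hX => U V /(@fst_continuous X Y (x, y)) xU /(@fst_continuous X Y (x', y')) V'.
  by have [[a b] []] := cl _ _ xU V'; exists a.
apply: hY => U V /(@snd_continuous X Y (x, y)) yU /(@snd_continuous X Y (x', y')) V'.
by have [[a b] []] := cl _ _ yU V'; exists b.
Qed.

Lemma closed_equalizer {X Y : topologicalType} (f g : X -> Y) :
  hausdorff_space Y -> continuous f -> continuous g ->
  closed [set x | f x = g x].
Proof.
move=> hY cf cg x fgx; apply: hY => U V /cf Ux /cg Vx.
have [y [fgy [Uy Vy]]] := fgx _ (@filterI _ (nbhs x) _ (f @^-1` U) (g @^-1` V) Ux Vx).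
by exists (g y); split => //; rewrite -fgy.
Qed.

(** The preimage of a closed [D] is the projection along [K] of the part of [C] lying over [D]. This
    gives continuity of maps obtained by choice, as soon as a closed relation determines their
    values. *)
Lemma closed_graph_continuous {X Y : topologicalType} (K : set Y)
    (C : set (X * Y)) (f : X -> Y) :
  compact K -> closed C -> (forall x, K (f x) /\ C (x, f x)) ->
  (forall x y, C (x, y) -> y = f x) -> continuous f.
Proof.
move=> cK cC fC Cf; apply/continuous_closedP => D cD.
have -> : f @^-1` D =
    [set x | exists2 y, K y & (C `&` (snd @^-1` D)) (x, y)].
  apply/seteqP; split=> [x Dfx|x [y Ky [/= /Cf -> //]]].
  by have [Kfx Cfx] := fC x; exists (f x).
apply: closed_projection => //; apply: closedI => //.
by apply: closed_preimage => //; exact: snd_continuous.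
Qed.

(** Near a point with [u <= 0], continuity keeps [v] below [e]; near a point with [u > 0], [u] stays
    away from 0 and a small [d] makes the premise false. Compactness yields a common [d]. For
    distances [u] and [v] this is uniform continuity. *)
Lemma compact_modulus {R : realType} {X : topologicalType} (A : set X)
    (u v : X -> R) (e : R) :
  compact A -> continuous u -> continuous v ->
  (forall x, A x -> u x <= 0 -> v x <= 0) -> 0 < e ->
  exists2 d, 0 < d & forall x, A x -> u x < d -> v x < e.
Proof.
move=> /compact_near_coveringP cA cu cv uv e0.
have : \forall d \near 0^'+, A `<=` [set x | u x < d -> v x < e].
  apply: cA => x Ax.
  have [ux|ux] := leP (u x) 0.
    have vx := le_lt_trans (uv x Ax ux) e0.
    near=> x' d => /= _; near: x'.
    by apply: (cvgr_lt _ (cv x)).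
  near=> x' d => /=.
  have : u x / 2 < u x'.
    by near: x'; apply: (cvgr_gt _ (cu x)); rewrite ltr_pdivrMr// ltr_pMr// ltr1n.
  have : d < u x / 2 by near: d; apply: nbhs_right_lt; rewrite divr_gt0.
  by move=> /lt_trans /[apply] /ltW; rewrite leNgt => /negP.
move=> /(filterI (nbhs_right_gt _)) /filter_ex [d [/= d0 Ad]].
by exists d.
Unshelve. all: by end_near. Qed.

Lemma mdist_le0_eq {R : realType} {M : metricType R} (x y : M) :
  mdist x y <= 0 -> x = y.
Proof.
by move=> xy; apply: (@mdist_positivity R); apply/eqP; rewrite eq_le xy mdist_ge0.
Qed.

Lemma mdist_continuous {R : realType} {M : metricType R} {X : topologicalType}
    (f g : X -> M) :
  continuous f -> continuous g -> continuous (fun x => mdist (f x) (g x)).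
Proof.
move=> cf cg x; apply/cvgrPdist_le => /= e e0.
have e2 : 0 < e / 2 by rewrite divr_gt0.
have fx := metricType_numDomainType.cvgr_dist_lt (cf x) e2.
have gx := metricType_numDomainType.cvgr_dist_lt (cg x) e2.
near=> y.
have fy : mdist (f x) (f y) < e / 2 by near: y; exact: fx.
have gy : mdist (g x) (g y) < e / 2 by near: y; exact: gx.
have := metric_triangle (f x) (f y) (g x).
have := metric_triangle (f y) (g y) (g x).
have := metric_triangle (f y) (f x) (g y).
have := metric_triangle (f x) (g x) (g y).
rewrite (metric_sym (f y) (f x)) (metric_sym (g y) (g x)) ler_norml.
by move=> ? ? ? ?; apply/andP; split; lra.
Unshelve. all: by end_near. Qed.

Lemma continuous_uniform_approx {R : realType} {X : topologicalType}
    {M : metricType R} (f : X -> M) :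
  (forall e : R, 0 < e -> exists2 h : X -> M,
     continuous h & forall x, mdist (h x) (f x) <= e) ->
  continuous f.
Proof.
move=> fh x; apply/metricType_numDomainType.cvgrPdist_lt => e e0.
have e3 : 0 < e / 3%:R by rewrite divr_gt0.
have [h ch hf] := fh _ e3.
have hx := metricType_numDomainType.cvgr_dist_lt (ch x) e3.
near=> y.
have hy : mdist (h x) (h y) < e / 3%:R by near: y; exact: hx.
have := hf x; have := hf y.
have := metric_triangle (f x) (h x) (f y).
have := metric_triangle (h x) (h y) (f y).
rewrite (metric_sym (f x) (h x)); lra.
Unshelve. all: by end_near. Qed.

(** A cluster point of [s] serves as the limit: each ball around it contains some [s l] with
    [k <= l], so the bound [c k] passes to it. *)
Lemma compact_cauchy_dist {R : realType} {M : metricType R} (s : nat -> M)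
    (c : nat -> R) :
  compact [set: M] ->
  (forall k l, (k <= l)%N -> mdist (s k) (s l) <= c k) ->
  exists z, forall k, mdist (s k) z <= c k.
Proof.
move=> cM sc.
have [z [_ clz]] := cM (s @ \oo) _ (@filterT _ (s @ \oo) _).
exists z => k; apply/ler_addgt0Pr => e e0.
have sk : (s @ \oo) (s @` [set l | (k <= l)%N]).
  by exists k => // l /= kl; exists l.
have nz : nbhs z (ball z e) by exact: nbhsx_ballx.
have [_ [[l /= kl <-]]] := clz _ _ sk nz.
rewrite ballEmdist /= => zl.
rewrite (le_trans (metric_triangle _ (s l) _))// lerD ?sc//.
by rewrite metric_sym ltW.
Qed.

(** * Families continuous jointly in the parameter and the point *)

Definition jointly_continuous {I X Y : topologicalType} (F : I -> X -> Y) :=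
  continuous (fun p : I * X => F p.1 p.2).

Section JointContinuity.
Context {I : topologicalType}.

Lemma jointly_continuous_comp {X Y Z : topologicalType}
    (F : I -> Y -> Z) (G : I -> X -> Y) :
  jointly_continuous F -> jointly_continuous G ->
  jointly_continuous (fun t x => F t (G t x)).
Proof.
move=> cF cG; apply: (continuous_compose
  (f := fun p : I * X => (p.1, G p.1 p.2)) (g := fun q : I * Y => F q.1 q.2)) => //.
by apply: continuous_pair => //; exact: fst_continuous.
Qed.

Lemma jointly_continuous_id {X : topologicalType} :
  jointly_continuous (fun (_ : I) (x : X) => x).
Proof. exact: snd_continuous. Qed.

Lemma jointly_continuous_iter {X : topologicalType} (F : I -> X -> X) n :
  jointly_continuous F -> jointly_continuous (fun t => iter n (F t)).
Proof.
move=> cF; elim: n => [|n IHn]; first exact: jointly_continuous_id.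
exact: (jointly_continuous_comp cF IHn).
Qed.

Lemma jointly_continuous_at {X Y : topologicalType} (F : I -> X -> Y) t :
  jointly_continuous F -> continuous (F t).
Proof.
move=> cF; apply: (continuous_compose
  (f := fun x => (t, x)) (g := fun q : I * X => F q.1 q.2)) => //.
by apply: continuous_pair; [move=> ?; exact: cvg_cst|move=> ?; exact: cvg_id].
Qed.

(** The inverse is determined by the closed relation [F t x = y], and its values lie in a compact
    space. *)
Lemma jointly_continuous_inverse {X Y : topologicalType}
    (F : I -> X -> Y) (F' : I -> Y -> X) :
  compact [set: X] -> hausdorff_space Y -> jointly_continuous F ->
  (forall t, cancel (F t) (F' t)) -> (forall t, cancel (F' t) (F t)) ->
  jointly_continuous F'.
Proof.
move=> cX hY cF FK F'K.
apply: (@closed_graph_continuous _ _ setT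
  [set q : (I * Y) * X | F q.1.1 q.2 = q.1.2]) => //.
- apply: closed_equalizer => //.
    apply: (continuous_compose (f := fun q : (I * Y) * X => (q.1.1, q.2)) _ cF).
    apply: continuous_pair; last exact: snd_continuous.
    by apply: continuous_compose; exact: fst_continuous.
  by apply: continuous_compose; [exact: fst_continuous|exact: snd_continuous].
- by move=> [t y]; split => //=; rewrite F'K.
- by move=> [t y] x /= <-; rewrite FK.
Qed.

End JointContinuity.
Arguments jointly_continuous_iter {I X F} n _.

(** Applying [compact_modulus] on [I * (M * M)] produces one [d] for all parameters. *)
Lemma jointly_continuous_modulus {R : realType} {I : topologicalType}
    {M N : metricType R} (F : I -> M -> N) (e : R) :
  compact [set: I] -> compact [set: M] -> jointly_continuous F -> 0 < e ->
  exists2 d, 0 < d &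
    forall t x y, mdist x y < d -> mdist (F t x) (F t y) < e.
Proof.
move=> cI cM cF e0.
have c1 : continuous (fun p : I * (M * M) => p.2.1).
  by apply: continuous_compose; [exact: snd_continuous|exact: fst_continuous].
have c2 : continuous (fun p : I * (M * M) => p.2.2).
  by apply: continuous_compose; [exact: snd_continuous|exact: snd_continuous].
have cFg (g : I * (M * M) -> M) :
    continuous g -> continuous (fun p => F p.1 (g p)).
  move=> cg; apply: (continuous_compose (f := fun p => (p.1, g p)) _ cF).
  by apply: continuous_pair => //; exact: fst_continuous.
have cIMM : compact [set: I * (M * M)].
  by rewrite -setXTT -(@setXTT M M); do 2?[apply: compact_setX].
have uv (p : I * (M * M)) : setT p -> mdist p.2.1 p.2.2 <= 0 ->
    mdist (F p.1 p.2.1) (F p.1 p.2.2) <= 0.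
  by move=> _ /mdist_le0_eq ->; rewrite mdistxx.
have [d d0 Fd] := compact_modulus cIMM (mdist_continuous c1 c2)
  (mdist_continuous (cFg _ c1) (cFg _ c2)) uv e0.
by exists d => // t x y xy; exact: (Fd (t, (x, y))).
Qed.

(** * Brown's theorem with parameters *)

(** Dependent choice along an invariant. The successor is chosen for every pair, with [s] itself as
    default when [s] is not valid. *)
Lemma iterated_choice {S : Type} (valid : nat -> S -> Prop)
    (next : nat -> S -> S -> Prop) (s0 : S) :
  valid 0%N s0 ->
  (forall n s, valid n s -> exists s', valid n.+1 s' /\ next n s s') ->
  exists u : nat -> S,
    [/\ u 0%N = s0, forall n, valid n (u n) & forall n, next n (u n) (u n.+1)].
Proof.
move=> v0 step.
have /choice [phi phiP] : forall p : nat * S, exists s', valid p.1 p.2 ->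
    valid p.1.+1 s' /\ next p.1 p.2 s'.
  move=> [n s] /=; have [/step [s' ?]|nv] := pselect (valid n s).
    by exists s'.
  by exists s.
pose fix u n := if n is k.+1 then phi (k, u k) else s0.
have uv n : valid n (u n) by elim: n => [//|n /(phiP (n, u n))[]].
by exists u; split => // n; have [] := phiP (n, u n) (uv n).
Qed.

Lemma iter_stable {T : Type} (f : T -> T) (B : set T) n b :
  f @` B = B -> B b -> B (iter n f b).
Proof.
by move=> fB Bb; elim: n => //= n IHn; rewrite -fB; exists (iter n f b).
Qed.

Lemma iter_stable_onto {T : Type} (f : T -> T) (B : set T) n b :
  f @` B = B -> B b -> exists2 z, B z & iter n f z = b.
Proof.
move=> fB; elim: n b => [|n IHn] b Bb; first by exists b.
have [z Bz zb] := IHn b Bb; move: Bz; rewrite -{1}fB => -[w Bw wz].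
by exists w => //; rewrite iterSr wz.
Qed.

Section Brown.
Context {R : realType} {I : topologicalType} {M : metricType R}.
Variables (H : I -> M -> M) (B : set M).
Hypotheses (cI : compact [set: I]) (cM : compact [set: M]).
Hypothesis cH : jointly_continuous H.
Hypothesis HB : forall t, H t @` B = B.
Hypothesis H_near_homeo : forall e : R, 0 < e ->
  exists F F' : I -> M -> M,
    [/\ jointly_continuous F, (forall t, cancel (F t) (F' t)),
        (forall t, cancel (F' t) (F t)),
        (forall t x, mdist (F t x) (H t x) < e) &
        forall t b, B b -> F t b = H t b].

Lemma iter_modulus n e : 0 < e ->
  exists2 d, 0 < d & forall k t x y, (k <= n)%N -> mdist x y < d ->
    mdist (iter k (H t) x) (iter k (H t) y) < e.
Proof.
move=> e0; elim: n => [|n [d d0 IHn]].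
  by exists e => // k t x y; rewrite leqn0 => /eqP ->.
have [d' d'0 Hd'] := jointly_continuous_modulus cI cM (jointly_continuous_iter n.+1 cH) e0.
exists (Num.min d d'); first by rewrite lt_min d0.
move=> k t x y; rewrite lt_min leq_eqVlt => /orP[/eqP -> /andP[_]|kn /andP[+ _]].
  exact: Hd'.
exact: IHn.
Qed.

(* A stage is a triple [((G, G^-1), e)], where [G = F_1 o ... o F_n]. *)
Let stage := ((I -> M -> M) * (I -> M -> M) * R)%type.

Let valid n (S : stage) :=
  [/\ jointly_continuous S.1.1, (forall t, cancel (S.1.1 t) (S.1.2 t)),
      (forall t, cancel (S.1.2 t) (S.1.1 t)),
      (forall t b, B b -> S.1.1 t b = iter n (H t) b) &
      [/\ 0 < S.2, S.2 <= 2 ^- n & forall t x y, mdist x y <= S.2 ->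
        mdist (S.1.1 t x) (S.1.1 t y) <= 2 ^- n]].

(* Since [e_(n+1) <= e_n / 2], the steps from stage [n] on add up to at most
   [e_n], which is a modulus of continuity of [G_n] for [2^-n]. *)
Let next n (S S1 : stage) :=
  S1.2 <= S.2 / 2 /\
  forall k t y, (k <= n)%N ->
    mdist (iter k (H t) (S.1.2 t y)) (iter k.+1 (H t) (S1.1.2 t y)) <= S.2 / 2.

(** Take [F] so close to [H] that replacing [G' y = F (F' (G' y))] by [H (F' (G' y))] moves it by
    less than [d], a modulus for the first [n] iterates of [H]. The new stage is [G o F]. *)
Let valid_next n S : valid n S -> exists S1, valid n.+1 S1 /\ next n S S1.
Proof.
case: S => [[G G'] e] [/= cG GK G'K GB [e0 e2 _]].
have e20 : 0 < e / 2 by rewrite divr_gt0.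
have [d d0 Hd] := iter_modulus n e20.
have [F [F' [cF FK F'K FH FB]]] := H_near_homeo d0.
have cGF : jointly_continuous (fun t x => G t (F t x)).
  exact: jointly_continuous_comp.
have p20 : 0 < 2 ^- n.+1 :> R by rewrite invr_gt0 exprn_gt0.
have [d' d'0 GFd'] := jointly_continuous_modulus cI cM cGF p20.
(* The bound [e / 2] makes the later steps summable to [e], [d' / 2] turns a strict modulus into one
   for [<=], and the power of 2 forces convergence to 0. *)
exists ((fun t x => G t (F t x), fun t y => F' t (G' t y)),
  Num.min (e / 2) (Num.min (d' / 2) (2 ^- n.+1))).
split; last first.
  split=> [|k t y kn] /=; first by rewrite ge_min lexx.
  rewrite -iterS iterSr metric_sym ltW//; apply: Hd => //.
  by rewrite metric_sym -{1}[G' t y](F'K t).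
split=> //=.
- by move=> t x; rewrite GK FK.
- by move=> t x; rewrite F'K G'K.
- by move=> t b Bb; rewrite FB// GB -?iterSr //; exact: (iter_stable 1 (HB t)).
split.
- by rewrite !lt_min e20 p20 divr_gt0.
- by rewrite !ge_min lexx !orbT.
- move=> t x y; rewrite !le_min => /and3P[_ xy _]; apply/ltW/GFd'.
  by rewrite (le_lt_trans xy)// ltr_pdivrMr// ltr_pMr// ltr1n.
Qed.

(** The maps [g i] are the coordinates of the bijection from [M] to backward orbits. That [G n]
    almost inverts [g n] will give injectivity; the last two clauses are surjectivity and the
    explicit form on [B], where [g i] undoes [H^i]. *)
Lemma brown_near_homeomorphism eps : 0 < eps ->
  exists G g : nat -> I -> M -> M,
    [/\ (forall n, jointly_continuous (G n) /\ jointly_continuous (g n)),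
        (forall i t y, H t (g i.+1 t y) = g i t y),
        (forall t y, mdist (g 0%N t y) y <= eps),
        (forall n t y, mdist (G n t (g n t y)) y <= 2 ^- n) &
        (forall t (x : nat -> M), (forall i, H t (x i.+1) = x i) ->
          exists y, forall i, g i t y = x i) /\
        (forall i t b, B b -> g i t (iter i (H t) b) = b)].
Proof.
move=> eps0.
pose s0 : stage := ((fun _ x => x, fun _ x => x), Num.min eps 1).
have v0 : valid 0%N s0.
  split=> //=; first exact: jointly_continuous_id.
  rewrite expr0 invr1; split; first by rewrite lt_min eps0 ltr01.
    by rewrite ge_min lexx orbT.
  by move=> t x y; rewrite le_min => /andP[].
have [u [u0 uv un]] := iterated_choice v0 valid_next.
pose G n := (u n).1.1; pose G' n := (u n).1.2; pose e n := (u n).2.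
have cG n : jointly_continuous (G n) by have [] := uv n.
have GK n t : cancel (G n t) (G' n t) by have [_ + _ _ _] := uv n; exact.
have G'K n t : cancel (G' n t) (G n t) by have [_ _ + _ _] := uv n; exact.
have GB n t b : B b -> G n t b = iter n (H t) b.
  by have [_ _ _ + _] := uv n; exact.
have e0 n : 0 < e n by have [_ _ _ _ []] := uv n.
have e2 n : e n <= 2 ^- n by have [_ _ _ _ []] := uv n.
have Gm n t x y : mdist x y <= e n -> mdist (G n t x) (G n t y) <= 2 ^- n.
  by have [_ _ _ _ [_ _ +]] := uv n; exact.
have eS n : e n.+1 <= e n / 2 by have [] := un n.
have HG' n k t y : (k <= n)%N ->
    mdist (iter k (H t) (G' n t y)) (iter k.+1 (H t) (G' n.+1 t y)) <= e n / 2.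
  by have [_ +] := un n; exact.
have e_small d : 0 < d -> exists N, forall n, (N <= n)%N -> e n < d.
  move=> d0; have [N _ Nd] := near_infty_natSinv_expn_lt (PosNum d0).
  by exists N => n /Nd /=; rewrite div1r; exact: le_lt_trans.
have cG' n : jointly_continuous (G' n).
  by apply: (jointly_continuous_inverse _ _ (cG n)) => //; exact: metric_hausdorff.
(* The bounds telescope: a step costs [e n / 2], which is at most [e n - e n.+1]. *)
have Hcauchy i t y k l : (k <= l)%N ->
    mdist (iter k (H t) (G' (i + k)%N t y)) (iter l (H t) (G' (i + l)%N t y))
      <= e (i + k)%N - e (i + l)%N.
  elim: l => [|l IHl]; first by rewrite leqn0 => /eqP ->; rewrite mdistxx subrr.
  rewrite leq_eqVlt => /orP[/eqP ->|]; first by rewrite mdistxx subrr.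
  rewrite ltnS => /IHl le1.
  have := HG' (i + l)%N l t y (leq_addl _ _).
  have := eS (i + l)%N; rewrite !addnS.
  have := metric_triangle (iter k (H t) (G' (i + k)%N t y))
    (iter l (H t) (G' (i + l)%N t y)) (iter l.+1 (H t) (G' (i + l).+1 t y)).
  by move=> /= *; lra.
have /choice [g0 g0P] : forall p : nat * I * M, exists z, forall k,
    mdist (iter k (H p.1.2) (G' (p.1.1 + k)%N p.1.2 p.2)) z <= e (p.1.1 + k)%N.
  move=> [[i t] y] /=.
  apply: (compact_cauchy_dist (s := fun k => iter k (H t) (G' (i + k)%N t y))
    (c := fun k => e (i + k)%N)) => // k l kl.
  by rewrite (le_trans (Hcauchy i t y k l kl))// gerBl ltW.
pose g i t y := g0 ((i, t), y).
have gP i t y k :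
    mdist (iter k (H t) (G' (i + k)%N t y)) (g i t y) <= e (i + k)%N.
  exact: (g0P ((i, t), y)).
have cg i : jointly_continuous (g i).
  apply: continuous_uniform_approx => d /e_small [N Nd].
  exists (fun p => iter N (H p.1) (G' (i + N)%N p.1 p.2)).
    exact: (jointly_continuous_comp (jointly_continuous_iter N cH)).
  by move=> [t y] /=; rewrite (le_trans (gP _ _ _ _))// ltW// Nd// leq_addl.
exists G, g; split => //.
- move=> i t y; apply: (@mdist_le0_eq R).
  apply/ler_addgt0Pr => d d0; rewrite add0r.
  have d20 : 0 < d / 2 by rewrite divr_gt0.
  have [d' d'0 Hd'] := jointly_continuous_modulus cI cM cH d20.
  have d'' : 0 < Num.min (d / 2) d' by rewrite lt_min d20.
  have [N Nd] := e_small _ d''.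
  (* Applying [H] to approximant [N] of [g i.+1] gives approximant [N.+1] of [g i]; both use the
     same [G']. *)
  have := gP i t y N.+1; rewrite addnS -addSn => g1.
  have g2 := gP i.+1 t y N.
  have := Nd (i.+1 + N)%N (leq_addl _ _); rewrite lt_min => /andP[d1 d2].
  have := Hd' t _ _ (le_lt_trans g2 d2).
  have := metric_triangle (H t (g i.+1 t y))
    (iter N.+1 (H t) (G' (i.+1 + N)%N t y)) (g i t y).
  rewrite (metric_sym (H t (g i.+1 t y)) (iter N.+1 _ _)) /= in g1 *.
  by move=> *; lra.
(* At stage 0, [G'] is the identity and the scale is at most [eps]. *)
- move=> t y; rewrite metric_sym.
  have := gP 0%N t y 0%N; rewrite /= /G' /e addn0 u0 /=.
  by rewrite le_min => /andP[].
(* Approximant 0 puts [G' n] within [e n] of [g n], and [e n] is a modulus for [G n]. *)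
- move=> n t y; rewrite metric_sym -{1}[y](G'K n t); apply: Gm.
  by have := gP n t y 0%N; rewrite addn0.
split.
  move=> t x Hx.
  have xiter k i : iter k (H t) (x (i + k)%N) = x i.
    by elim: k i => [|k IHk] i; rewrite ?addn0// iterS addnS -addSn IHk.
  (* The required point is a cluster point of [s]: for [n >= i], approximant [n - i] of [g i] at
     [s n] is exactly [x i], so [g i (s n)] is within [e n] of [x i]. *)
  pose s n := G n t (x n).
  have [y [_ cly]] := @cM (s @ \oo) _ (@filterT _ (s @ \oo) _).
  exists y => i; apply: (@mdist_le0_eq R).
  apply/ler_addgt0Pr => d d0; rewrite add0r.
  have d20 : 0 < d / 2 by rewrite divr_gt0.
  have [d' d'0 gd'] := jointly_continuous_modulus cI cM (cg i) d20.
  have [N Nd] := e_small _ d20.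
  have sN : (s @ \oo) (s @` [set n | (maxn N i <= n)%N]).
    by exists (maxn N i) => // n /= Nn; exists n.
  have [_ [[n /= + <-]]] := cly _ _ sN (nbhsx_ballx y d' d'0).
  rewrite geq_max ballEmdist /= => /andP[Nn i_n] /(gd' t).
  have := gP i t (s n) (n - i)%N; rewrite subnKC// /s GK.
  have := xiter (n - i)%N i; rewrite subnKC// => ->.
  have := metric_triangle (g i t y) (g i t (s n)) (x i).
  have := Nd n Nn; rewrite (metric_sym (x i)).
  by rewrite /s => *; lra.
move=> i t b Bb; apply/esym/(@mdist_le0_eq R).
apply/ler_addgt0Pr => d /e_small [N Nd]; rewrite add0r.
(* Write [b = H^N z] with [z] in [B]. Then [H^i b = H^(i+N) z = G (i + N) z], so approximant [N] of
   [g i] at [H^i b] equals [b]. *)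
have [z Bz zb] := iter_stable_onto N (HB t) Bb.
have := gP i t (iter i (H t) b) N.
rewrite -{1}zb -iterD -(GB (i + N)%N)// GK zb => /le_trans; apply.
by rewrite ltW// Nd// leq_addl.
Qed.

End Brown.

(** * Smashing along the collar *)

(* [v x * min 1 (w / u x)] is the smallest function of [w] that is at least
   [v x] at [u x] and whose quotient by [w] is nonincreasing; the supremum over
   [x] is continuous because this family is equicontinuous. *)
Lemma exists_majorant {R : realType} {X : topologicalType} (u v : X -> R) :
  compact [set: X] -> continuous u -> continuous v ->
  (forall x, 0 <= u x) -> (forall x, 0 <= v x <= 1) ->
  (forall x, u x <= 0 -> v x <= 0) ->
  exists lam : R -> R,
    [/\ continuous lam, {in `[0, 1] &, {homo lam : w w' / w <= w'}},
        lam 0 = 0 /\ lam 1 = 1,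
        (forall w, 0 <= w -> w <= lam w) & forall x, v x <= lam (u x)].
Proof.
move=> cX cu cv u0 v01 uv.
have v0 x : 0 <= v x by case/andP: (v01 x).
have v1 x : v x <= 1 by case/andP: (v01 x).
(* If [u x = 0], the quotient is 0 by the convention on division; there [v x = 0] as well, so
   nothing is lost. *)
pose b x w := v x * Num.min 1 (w / u x).
(* Including [w] itself makes the supremum at least the identity. *)
pose S w := [set w] `|` [set b x w | x in [set: X]].
have b1 x w : b x w <= 1.
  rewrite /b; have [w1|w1] := leP 1 (w / u x); first by rewrite mulr1.
  have [w0|w0] := leP 0 (w / u x); first by rewrite mulr_ile1// ltW.
  by rewrite (le_trans _ ler01)// mulr_ge0_le0// ltW.
have bmono x w w' : w <= w' -> b x w <= b x w'.
  move=> ww'; rewrite /b ler_wpM2l// le_min !ge_min lexx /=.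
  by rewrite ler_wpM2r ?invr_ge0// orbT.
have supS w : has_sup (S w).
  split; first by exists w; left.
  exists (Num.max 1 w) => _ [-> |[x _ <-]]; first by rewrite le_max lexx orbT.
  by rewrite le_max b1.
pose mu w := sup (S w).
have le_mu w : w <= mu w by apply: (ub_le_sup (proj2 (supS w))); left.
have b_mu x w : b x w <= mu w.
  by apply: (ub_le_sup (proj2 (supS w))); right; exists x.
have mu_le w c : w <= c -> (forall x, b x w <= c) -> mu w <= c.
  move=> wc bc; apply: ge_sup; first by exists w; left.
  by move=> _ [-> //|[x _ <-]].
have mumono w w' : w <= w' -> mu w <= mu w'.
  move=> ww'; apply: mu_le; first exact: le_trans ww' (le_mu _).
  by move=> x; rewrite (le_trans (bmono x _ _ ww'))// b_mu.
have mu_modulus e : 0 < e -> exists2 d, 0 < d & forall w w', 0 <= w -> w <= w' ->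
    w' - w < d -> mu w' <= mu w + e.
  move=> e0; have [a a0 ua] := compact_modulus cX cu cv (fun x _ => @uv x) e0.
  (* The factor 1 handles the member [w]. For the members [b x]: where [u x < a] they are bounded by
     [v x < e], and where [u x >= a] the quotient by [u x] has slope at most [1 / a]. *)
  exists (e * Num.min a 1); first by rewrite mulr_gt0// lt_min a0 ltr01.
  move=> w w' w0 ww' dw.
  have dw1 : w' - w <= e.
    by rewrite (le_trans (ltW dw))// ler_piMr ?(ltW e0)// ge_min lexx orbT.
  have dwa : w' - w <= e * a.
    by rewrite (le_trans (ltW dw))// ler_wpM2l ?(ltW e0)// ge_min lexx.
  apply: mu_le; first by have := le_mu w; lra.
  move=> x; suff : b x w' <= b x w + e by have := b_mu x w; lra.
  have [ux|ux] := ltP (u x) a.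
    have vx := ua x I ux.
    have -> : b x w' <= b x w + e = (b x w' <= e + b x w) by rewrite addrC.
    rewrite ler_wpDr//; first by rewrite /b mulr_ge0// le_min ler01 divr_ge0.
    by rewrite (le_trans _ (ltW vx))// /b ler_piMr// ge_min lexx.
  have ux0 : 0 < u x by rewrite (lt_le_trans a0).
  have we : w' / u x <= w / u x + e.
    rewrite -lerBlDl -mulrBl ler_pdivrMr// (le_trans dwa)// ler_wpM2l// ltW//.
  have : Num.min 1 (w' / u x) <= Num.min 1 (w / u x) + e.
    by rewrite /Num.min; do 2 case: ifP => ?; lra.
  by rewrite /b => /(ler_wpM2l (v0 x)); have := ler_piMl (ltW e0) (v1 x); lra.
have mu0 : mu 0 = 0.
  apply/eqP; rewrite eq_le le_mu andbT; apply: mu_le => // x.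
  by rewrite /b mul0r min_r ?ler01// mulr0.
(* The modulus of [mu] is known only for nonnegative arguments; the absolute value extends it
   continuously to the whole line. *)
exists (fun w => mu `|w|); split.
- move=> w; apply/cvgrPdist_le => e e0; have [d d0 mud] := mu_modulus e e0.
  near=> w'.
  have : `|w - w'| < d by near: w'; apply: cvgr_dist_lt => //; exact: cvg_id.
  have := ler_dist_dist w w'; rewrite ler_norml => /andP[? ?] ww'; rewrite ler_norml.
  have [l|l] := leP `|w| `|w'|.
    have := mud `|w| `|w'| (normr_ge0 _) l; have := mumono _ _ l.
    by move=> ? mudw; have := mudw ltac:(lra); lra.
  have := mud `|w'| `|w| (normr_ge0 _) (ltW l); have := mumono _ _ (ltW l).
  by move=> ? mudw; have := mudw ltac:(lra); lra.
- move=> w w'; rewrite !in_itv /= => /andP[w0 _] /andP[w'0 _] ww'.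
  by rewrite !ger0_norm//; exact: mumono.
- split; first by rewrite normr0.
  rewrite normr1; apply/eqP; rewrite eq_le le_mu andbT; exact: mu_le.
- by move=> w w0; rewrite ger0_norm.
- move=> x; rewrite ger0_norm//.
  have [ux|ux] := leP (u x) 0; first by rewrite (le_trans (uv x ux))// (le_trans (u0 x)).
  by rewrite (le_trans _ (b_mu x _))// /b divff ?gt_eqF// minxx mulr1.
Unshelve. all: by end_near. Qed.

Section Smash.
Context {R : realType} {M : metricType R}.
Variables (B E : set M) (Psi : M * R -> M).
Hypotheses (cM : compact [set: M]) (clB : closed B).
Hypothesis cPsi : {within B `*` `[0, 1], continuous Psi}.
Hypothesis Psi_bij : set_bij (B `*` `[0, 1[) (~` E) Psi.
Hypothesis Psi0 : forall eta, B eta -> Psi (eta, 0) = eta.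
Hypothesis Psi1 : Psi @` (B `*` [set 1]) = E.

Let in01 (s : R) := 0 <= s <= 1.

Lemma Psi1_E eta : B eta -> E (Psi (eta, 1)).
Proof. by move=> Beta; rewrite -Psi1; exists (eta, 1). Qed.

Lemma Psi_notE eta s : B eta -> 0 <= s < 1 -> ~ E (Psi (eta, s)).
Proof.
move=> Beta s01; have [+ _ _] := Psi_bij; apply.
by split => //=; rewrite in_itv.
Qed.

Lemma Psi_onto x : exists p, [/\ B p.1, in01 p.2 & Psi p = x].
Proof.
have [|nEx] := pselect (E x).
  by rewrite -Psi1 => -[[eta s] [/= Beta ->] <-]; exists (eta, 1); rewrite /in01 ler01 lexx.
have [_ _ /(_ x nEx)] := Psi_bij.
move=> [[eta s] [/= Beta]]; rewrite in_itv /= => /andP[s0 s1] <-.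
by exists (eta, s); split => //; rewrite /in01 s0 ltW.
Qed.

(** Height 1 means lying in [E], so heights always agree; feet agree only below height 1, where
    [Psi] is injective. *)
Lemma Psi_eq eta s eta' s' : B eta -> B eta' -> in01 s -> in01 s' ->
  Psi (eta, s) = Psi (eta', s') -> s = s' /\ (s < 1 -> eta = eta').
Proof.
move=> Be Be' /andP[s0 s1] /andP[s'0 s'1] P.
have [sl|sl] := ltP s 1; have [sl'|sl'] := ltP s' 1.
- have [_ + _] := Psi_bij => /(_ (eta, s) (eta', s')).
  by rewrite !inE /= !in_itv /= s0 s'0 sl sl' => /(_ (conj Be isT) (conj Be' isT) P) [].
- have s'E : s' = 1 by apply/eqP; rewrite eq_le s'1.
  have := @Psi_notE eta s Be; rewrite s0 sl P s'E => /(_ isT); case; exact: Psi1_E.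
- have sE : s = 1 by apply/eqP; rewrite eq_le s1.
  have := @Psi_notE eta' s' Be'; rewrite s'0 sl' -P sE => /(_ isT); case; exact: Psi1_E.
- by split => //; apply/eqP; rewrite eq_le (le_trans s1 sl') (le_trans s'1 sl).
Qed.

(** The graph of [Psi] over the closed collar. Its compactness stands in for a continuous inverse of
    [Psi], which may fail to exist at height 1. *)
Let P := [set q : (M * R) * M | [/\ B q.1.1, in01 q.1.2 & Psi q.1 = q.2]].

Let compactB : compact B.
Proof. by apply: (subclosed_compact clB cM). Qed.

Let compactB01 : compact (B `*` `[0 : R, 1]).
Proof. by apply: compact_setX => //; exact: segment_compact. Qed.

Let compactP : compact P.
Proof.
have -> : P = (fun p => (p, Psi p)) @` (B `*` `[0, 1]).
  apply/seteqP; split=> [[[eta s] x] /= [Be s01 Px]|_ [[eta s] [/= Be s01] <-]].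
    by exists (eta, s); [split => //=; rewrite in_itv|rewrite Px].
  by split => //=; move: s01; rewrite in_itv.
apply: continuous_compact => //.
apply: continuous_pair => //.
by apply: continuous_subspaceT => p; exact: cvg_id.
Qed.

Let hausdorffMRM : hausdorff_space ((M * R) * M)%type.
Proof.
apply: hausdorff_prod; last exact: metric_hausdorff.
by apply: hausdorff_prod; [exact: metric_hausdorff|exact: Rhausdorff].
Qed.

Let closedP : closed P.
Proof. exact: compact_closed. Qed.

Lemma exists_collar_coordinates : exists (foot : M -> M) (height : M -> R),
  forall x, [/\ B (foot x), 0 <= height x <= 1 & Psi (foot x, height x) = x].
Proof.
have /choice [c cP] := Psi_onto.
exists (fun x => (c x).1), (fun x => (c x).2) => x.
by have := cP x; case: (c x).
Qed.

(** [compact_modulus] on the pairs of points of the graph [P] that have the same foot, with the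
    height difference as [u]. *)
Lemma collar_modulus e : 0 < e -> exists2 d, 0 < d & forall eta s s',
  B eta -> 0 <= s <= 1 -> 0 <= s' <= 1 -> `|s - s'| < d ->
  mdist (Psi (eta, s)) (Psi (eta, s')) < e.
Proof.
move=> e0; pose T : Type := ((M * R) * M)%type.
have c1 : continuous (fun q : T * T => q.1) := fst_continuous.
have c2 : continuous (fun q : T * T => q.2) := snd_continuous.
have cfoot : continuous (fun p : T => p.1.1) :=
  continuous_compose fst_continuous fst_continuous.
have cheight : continuous (fun p : T => p.1.2) :=
  continuous_compose fst_continuous snd_continuous.
have cpt : continuous (fun p : T => p.2) := snd_continuous.
have cA : compact ((P `*` P) `&` [set q : T * T | q.1.1.1 = q.2.1.1]).
  apply: compact_closedI; first exact: compact_setX.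
  by apply: closed_equalizer; [exact: metric_hausdorff| |];
    apply: continuous_compose cfoot.
have cu : continuous (fun q : T * T => `|q.1.1.2 - q.2.1.2|).
  move=> q; apply: cvg_norm; apply: cvgB.
    exact: (continuous_compose c1 cheight).
  exact: (continuous_compose c2 cheight).
have cv := mdist_continuous (continuous_compose c1 cpt) (continuous_compose c2 cpt).
have uv (q : T * T) : ((P `*` P) `&` [set q : T * T | q.1.1.1 = q.2.1.1]) q ->
    `|q.1.1.2 - q.2.1.2| <= 0 -> mdist q.1.2 q.2.2 <= 0.
  case: q => [[[eta s] x] [[eta' s'] x']] [[[/= _ _ <-] [/= _ _ <-]] /= <-].
  by rewrite normr_le0 subr_eq0 => /eqP ->; rewrite mdistxx.
have [d d0 Pd] := compact_modulus cA cu cv uv e0.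
exists d => // eta s s' Be s01 s'01 ss'.
exact: (Pd (((eta, s), Psi (eta, s)), ((eta, s'), Psi (eta, s')))).
Qed.

(* On [E] the foot is an arbitrary choice, because [Psi (-, 1)] need not be
   injective; the smash does not depend on it as soon as [lam 1 = 1]. *)
Variables (foot : M -> M) (height : M -> R).
Hypothesis footP : forall x,
  [/\ B (foot x), 0 <= height x <= 1 & Psi (foot x, height x) = x].

Let Bfoot x : B (foot x). Proof. by have [] := footP x. Qed.
Let h01 x : 0 <= height x <= 1. Proof. by have [] := footP x. Qed.
Let Psi_foot x : Psi (foot x, height x) = x. Proof. by have [] := footP x. Qed.

Lemma height_Psi eta s : B eta -> 0 <= s <= 1 -> height (Psi (eta, s)) = s.
Proof.
by move=> Be s01; have [] := Psi_eq (Bfoot _) Be (h01 _) s01 (Psi_foot (Psi (eta, s))).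
Qed.

Lemma height_eq0 x : (height x == 0) = (x \in B).
Proof.
apply/eqP/idP => [h0|/set_mem Bx].
  by apply: mem_set; rewrite -(Psi_foot x) h0 Psi0.
by rewrite -[x]Psi0// height_Psi// lexx ler01.
Qed.

Lemma height_eq1 x : (height x == 1) = (x \in E).
Proof.
apply/eqP/idP => [h1|/set_mem].
  by apply: mem_set; rewrite -(Psi_foot x) h1; exact: Psi1_E.
by rewrite -Psi1 => -[[eta s] [/= Be ->] <-]; rewrite height_Psi// lexx ler01.
Qed.

(** Projecting the closed graph [P] along the compact set of feet leaves a closed relation between
    points and heights. *)
Lemma height_continuous : continuous height.
Proof.
apply: (@closed_graph_continuous M R `[0, 1]
    [set q : M * R | exists2 eta, B eta & P ((eta, q.2), q.1)] height).
- exact: segment_compact.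
- apply: (@closed_projection _ _ B
    [set q : (M * R) * M | P ((q.2, q.1.2), q.1.1)]) => //.
  apply: (closed_preimage (f := fun q : (M * R) * M => ((q.2, q.1.2), q.1.1))) => //.
  apply: continuous_pair.
    apply: continuous_pair; first exact: snd_continuous.
    exact: (continuous_compose fst_continuous snd_continuous).
  exact: (continuous_compose fst_continuous fst_continuous).
- move=> x; split; first by rewrite /= in_itv /= h01.
  by exists (foot x) => //; split; [exact: Bfoot|exact: h01|exact: Psi_foot].
- by move=> x s [eta Be [/= _ s01 <-]]; rewrite height_Psi.
Qed.

Definition smash (lam : R -> R) x := Psi (foot x, lam (height x)).

Section SmashMap.
Variable lam : R -> R.
Hypotheses (clam : continuous lam)
  (lam01 : forall s, 0 <= s <= 1 -> 0 <= lam s <= 1) (lam1 : lam 1 = 1).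

Lemma smash_Psi eta s : B eta -> 0 <= s <= 1 ->
  smash lam (Psi (eta, s)) = Psi (eta, lam s).
Proof.
move=> Be s01; rewrite /smash height_Psi//.
have [_] := Psi_eq (Bfoot _) Be (h01 _) s01 (Psi_foot (Psi (eta, s))).
rewrite height_Psi// => footE.
have [s1|s1] := ltP s 1; first by rewrite footE.
have -> : s = 1 by apply/eqP; rewrite eq_le s1; case/andP: s01 => _ ->.
by have := Psi_foot (Psi (eta, 1)); rewrite lam1 height_Psi// ler01 lexx.
Qed.

Lemma height_smash x : height (smash lam x) = lam (height x).
Proof. by rewrite height_Psi ?lam01. Qed.

Lemma smash_E x : E x -> smash lam x = x.
Proof.
move=> /mem_set; rewrite -height_eq1 => /eqP h1.
by rewrite -{2}(Psi_foot x) /smash h1 lam1.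
Qed.

(** The pairs [(Psi (eta, s), Psi (eta, lam s))] form a closed relation, being a projection along
    the compact collar; [smash_Psi] shows that it is a graph. No continuity of [foot] enters. *)
Lemma smash_continuous : continuous (smash lam).
Proof.
apply: (@closed_graph_continuous _ _ setT [set q : M * M |
    exists2 p, (B `*` `[0, 1]) p & (P (p, q.1) /\ P ((p.1, lam p.2), q.2))]) => //.
- apply: (@closed_projection (M * M)%type (M * R)%type (B `*` `[0, 1])
    ([set q : (M * M) * (M * R) | P (q.2, q.1.1)] `&` [set q | P ((q.2.1, lam q.2.2), q.1.2)])) => //.
  have cM1 : continuous (fun q : (M * M) * (M * R) => q.1.1) :=
    continuous_compose fst_continuous fst_continuous.
  have cM2 : continuous (fun q : (M * M) * (M * R) => q.1.2) :=
    continuous_compose fst_continuous snd_continuous.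
  have c1 : continuous (fun q : (M * M) * (M * R) => q.2.1) :=
    continuous_compose snd_continuous fst_continuous.
  have c2 : continuous (fun q : (M * M) * (M * R) => q.2.2) :=
    continuous_compose snd_continuous snd_continuous.
  apply: closedI.
    apply: (closed_preimage (f := fun q : (M * M) * (M * R) => (q.2, q.1.1))) => //.
    by apply: continuous_pair => //; exact: snd_continuous.
  apply: (closed_preimage
    (f := fun q : (M * M) * (M * R) => ((q.2.1, lam q.2.2), q.1.2))) => //.
  apply: continuous_pair => //; apply: continuous_pair => //.
  exact: (continuous_compose c2 clam).
- move=> x; split => //; exists (foot x, height x).
    by split => //=; rewrite in_itv /= h01.
  split; split => //=; [exact: h01|exact: lam01 (h01 x)].
- move=> x y [[eta s] _ [[/= Be s01 <-] [/= _ _ <-]]].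
  by rewrite smash_Psi.
Qed.

(** Heights are recovered by strict monotonicity. Below height 1 the image also stays below 1, so
    the foot is recovered; at height 1 the smash is the identity. Surjectivity is the intermediate
    value theorem on each collar line. *)
Lemma smash_bijective : lam 0 = 0 ->
  {in `[0, 1] &, {homo lam : s s' / s < s'}} ->
  exists smash' : M -> M, cancel (smash lam) smash' /\ cancel smash' (smash lam).
Proof.
move=> lam0 lam_mono.
have lam_inj : {in `[0, 1] &, injective lam}.
  move=> s s' sI s'I ll; apply/eqP; rewrite eq_le !leNgt.
  apply/andP; split; apply/negP => /lam_mono; rewrite ll ltxx => abs.
    by have := abs s'I sI.
  by have := abs sI s'I.
have hI x : height x \in `[0, 1] by rewrite in_itv /= h01.
have inj : injective (smash lam).
  move=> x x' xx'; have : lam (height x) = lam (height x').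
    by rewrite -!height_smash xx'.
  move=> /lam_inj -/(_ (hI x) (hI x')) hh.
  have [hx|hx] := eqVneq (height x) 1.
    have Ex : E x by move/eqP: hx; rewrite height_eq1 inE.
    have Ex' : E x' by move/eqP: hx; rewrite hh height_eq1 inE.
    by move: xx'; rewrite !smash_E.
  have [_] := Psi_eq (Bfoot x) (Bfoot x') (lam01 (h01 x)) (lam01 (h01 x')) xx'.
  rewrite -{1}lam1 => ff; rewrite -(Psi_foot x) -(Psi_foot x') hh ff//.
  apply: lam_mono => //; first by rewrite in_itv /= ler01 lexx.
  by case/andP: (h01 x) => _; rewrite le_eqVlt (negPf hx).
have surj y : exists x, smash lam x = y.
  have [|s] := @IVT R lam 0 1 (height y) ler01 (continuous_subspaceT clam).
    by rewrite lam0 lam1 min_l ?max_r ?ler01.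
  rewrite in_itv /= => s01 ls; exists (Psi (foot y, s)).
  by rewrite smash_Psi// ls.
have [smash' smash'K] := choice surj.
by exists smash'; split => // x; apply: inj; rewrite smash'K.
Qed.

End SmashMap.

End Smash.

(** * The unwrapping followed by a smash *)

Lemma continuous_withinT {X Y : topologicalType} (f : X -> Y) :
  {within [set: X], continuous f} -> continuous f.
Proof.
by rewrite continuous_open_subspace; [move=> cf x; apply: cf; rewrite inE|exact: openT].
Qed.

Lemma manifold_boundary_closed (R : realType) n (M : topologicalType) :
  closed (manifold_boundary R n M).
Proof.
rewrite /manifold_boundary closedC openE => p [U [W [phi [[oU Up] oW hphi]]]].
apply: filterS (open_nbhs_nbhs (conj oU Up)) => q Uq.
by exists U, W, phi; split.
Qed.

Lemma manifold_interior_homeo (R : realType) n (M : topologicalType)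
    (h h' : M -> M) :
  continuous h -> continuous h' -> cancel h h' -> cancel h' h ->
  forall x, manifold_interior R n M x -> manifold_interior R n M (h x).
Proof.
move=> ch ch' hK h'K x [U [W [phi [[oU Ux] oW [cphi [phiW phi_inj phi_surj] [k [ck kK]]]]]]].
have oU' : open (h' @^-1` U) by move/continuousP: ch'; exact.
exists (h' @^-1` U), W, (phi \o h'); split=> //.
  by split => //=; rewrite hK.
split.
- rewrite continuous_open_subspace// => y; rewrite inE /= => Uy.
  apply: continuous_comp; first exact: ch'.
  by move: cphi; rewrite continuous_open_subspace//; apply; rewrite inE.
- split.
  + by move=> y /= /phiW.
  + move=> y z; rewrite !inE => Uy Uz /= yz; rewrite -(h'K y) -(h'K z).
    by congr h; apply: phi_inj; rewrite ?inE.
  + move=> w /phi_surj [y Uy <-]; exists (h y); rewrite /= ?hK//.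
- exists (fun w => h (k w)); split; last by move=> y /= /kK ->; rewrite h'K.
  exact: (continuous_compose ck ch).
Qed.

(** The half keeps the inequality strict when passing to the supremum. *)
Lemma uniform_dist_lt {R : realType} {X : Type} {Y : metricType R} (A : set X)
    (f g : X -> Y) (e : R) :
  0 < e -> (forall x, A x -> mdist (f x) (g x) <= e / 2) ->
  (uniform_dist A f g < e%:E)%E.
Proof.
move=> e0 fg; apply: (@le_lt_trans _ _ (e / 2)%:E).
  by apply: ge_ereal_sup => _ [x Ax <-]; rewrite lee_fin fg.
by rewrite lte_fin ltr_pdivrMr// ltr_pMr// ltr1n.
Qed.

Lemma lt_uniform_dist {R : realType} {X : Type} {Y : metricType R} (A : set X)
    (f g : X -> Y) (e : R) x :
  (uniform_dist A f g < e%:E)%E -> A x -> mdist (f x) (g x) < e.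
Proof.
move=> fge Ax; rewrite -lte_fin; apply: le_lt_trans fge.
by apply: ereal_sup_ubound; exists x.
Qed.

(** Together with [jointly_continuous_parameter], this translates between uniform continuity in the
    parameter and joint continuity. *)
Lemma parameter_continuous_joint {R : realType} {I X : topologicalType}
    {Y : metricType R} (F : I -> X -> Y) :
  (forall t, continuous (F t)) -> parameter_continuous [set: X] F ->
  jointly_continuous F.
Proof.
move=> cF pF [t x]; apply/metricType_numDomainType.cvgrPdist_lt => e e0 /=.
have e2 : 0 < e / 2 by rewrite divr_gt0.
have Ft := metricType_numDomainType.cvgr_dist_lt (cF t x) e2.
near=> p.
have p1 : (uniform_dist setT (F p.1) (F t) < (e / 2)%:E)%E.
  by near: p; exact: (@fst_continuous I X (t, x) _ (pF t _ e2)).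
have p2 : mdist (F t x) (F t p.2) < e / 2.
  by near: p; exact: (@snd_continuous I X (t, x)
    [set y | mdist (F t x) (F t y) < e / 2] (Ft _)).
have := lt_uniform_dist p1 (Logic.I : setT p.2).
have := metric_triangle (F t x) (F t p.2) (F p.1 p.2).
rewrite (metric_sym (F p.1 p.2)); lra.
Unshelve. all: by end_near. Qed.

Lemma jointly_continuous_near {R : realType} {I X : topologicalType}
    {Y : metricType R} (F : I -> X -> Y) t e :
  compact [set: X] -> jointly_continuous F -> 0 < e ->
  \forall s \near t, forall x, mdist (F s x) (F t x) < e.
Proof.
move=> /compact_near_coveringP cX cF e0.
have : \forall s \near t, [set: X] `<=` [set x | mdist (F s x) (F t x) < e].
  apply: cX => x _.
  have cD : continuous (fun p : X * I => mdist (F p.2 p.1) (F t p.1)).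
    apply: mdist_continuous.
      apply: (continuous_compose (f := fun p : X * I => (p.2, p.1)) _ cF).
      by apply: continuous_pair; [exact: snd_continuous|exact: fst_continuous].
    exact: (continuous_compose fst_continuous (jointly_continuous_at cF)).
  by apply: (cvgr_lt _ (cD (x, t))); rewrite /= mdistxx.
by apply: filterS => s sub x; exact: sub.
Qed.

Lemma jointly_continuous_parameter {R : realType} {I X : topologicalType}
    {Y : metricType R} (F : I -> X -> Y) (A : set X) :
  compact [set: X] -> jointly_continuous F -> parameter_continuous A F.
Proof.
move=> cX cF t e e0; have e2 : 0 < e / 2 by rewrite divr_gt0.
apply: filterS (jointly_continuous_near t cX cF e2) => s Fst.
by apply: uniform_dist_lt => // x _; exact: ltW.
Qed.

Lemma bijective_inverse {X Y : Type} (f : X -> Y) :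
  set_bij [set: X] [set: Y] f -> exists f', cancel f f' /\ cancel f' f.
Proof.
move=> [_ inj surj].
have /choice [f' f'K] : forall y, exists x, f x = y.
  by move=> y; have [x _ xy] := surj y I; exists x.
exists f'; split => // x; apply: inj; rewrite ?inE//; exact: f'K.
Qed.

Lemma homeomorphismT {X Y : topologicalType} (f : X -> Y) (f' : Y -> X) :
  continuous f -> continuous f' -> cancel f f' -> cancel f' f ->
  homeomorphism [set: X] [set: Y] f.
Proof.
move=> cf cf' fK f'K; split; first exact: continuous_subspaceT.
  split => //; first by move=> x y _ _ /(can_inj fK).
  by move=> y _; exists (f' y).
by exists f'; split => //; exact: continuous_subspaceT.
Qed.

Section NearHomeo.
Context {R : realType} {I : topologicalType} {M : metricType R}.
Variables (B E : set M) (Psi : M * R -> M).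
Hypotheses (cI : compact [set: I]) (cM : compact [set: M]) (clB : closed B).
Hypothesis cPsi : {within B `*` `[0, 1], continuous Psi}.
Hypothesis Psi_bij : set_bij (B `*` `[0, 1[) (~` E) Psi.
Hypothesis Psi0 : forall eta, B eta -> Psi (eta, 0) = eta.
Hypothesis Psi1 : Psi @` (B `*` [set 1]) = E.
Variable r : M -> M.
Hypothesis rPsi : forall eta s, B eta -> 0 <= s <= 1 ->
  r (Psi (eta, s)) = Psi (eta, 1).
Variable fbar : I -> M -> M.
Hypothesis cfbar : jointly_continuous fbar.
Hypothesis fbar_bij : forall t, set_bij [set: M] [set: M] (fbar t).
Hypothesis fbarB : forall t x, B (fbar t x) <-> B x.

(** Choose [lam] so that one application of [H] at least doubles the height, capped at 1. Positive
    heights then reach 1, that is [E], in finitely many steps, and points of [E] go to the end of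
    the collar line of their [fbar]-image, where [r] sends that image. *)
Lemma smashed_unwrapping : exists H : I -> M -> M,
  [/\ jointly_continuous H,
      (forall t x, B x -> H t x = fbar t x) /\ (forall t x, B (H t x) -> B x),
      (forall t x, E x -> H t x = r (fbar t x)),
      (forall t x, ~ B x -> exists L, E (iter L (H t) x)) &
      forall e : R, 0 < e -> exists F F' : I -> M -> M,
        [/\ jointly_continuous F, (forall t, cancel (F t) (F' t)),
            (forall t, cancel (F' t) (F t)),
            (forall t x, mdist (F t x) (H t x) < e) &
            forall t b, B b -> F t b = H t b]].
Proof.
have [foot [height footP]] := exists_collar_coordinates Psi_bij Psi1.
have h01 x : 0 <= height x <= 1 by have [] := footP x.
have h0 x : 0 <= height x by case/andP: (h01 x).
have ch : continuous height := height_continuous cM clB cPsi Psi_bij Psi1 footP.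
have hB := height_eq0 Psi_bij Psi0 Psi1 footP.
have hE := height_eq1 Psi_bij Psi1 footP.
have cIM : compact [set: I * M] by rewrite -setXTT; exact: compact_setX.
pose u (p : I * M) := height (fbar p.1 p.2).
pose v (p : I * M) := Num.min 1 (2 * height p.2).
have cu : continuous u by exact: (continuous_compose cfbar ch).
have cv : continuous v.
  move=> p; apply: (@continuous_min R _ (fun=> 1)
    (fun p : I * M => 2 * height p.2)); first exact: cvg_cst.
  by apply: cvgMl_tmp; exact: (continuous_compose snd_continuous ch).
have v01 p : 0 <= v p <= 1 by rewrite le_min ler01 mulr_ge0//= ge_min lexx.
(* Since [fbar] preserves [B], height 0 after [fbar] forces height 0 before; this permits a majorant
   with [lam 0 = 0]. *)
have uv p : u p <= 0 -> v p <= 0.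
  move=> up; have /eqP : u p = 0 by apply/eqP; rewrite eq_le up h0.
  rewrite hB inE fbarB -in_setE -hB => /eqP hp.
  by rewrite /v hp mulr0 ge_min lexx orbT.
have [lam [clam lam_mono [lam0 lam1] lam_id lam_v]] :=
  exists_majorant cIM cu cv (fun p => h0 _) v01 uv.
have I0 : (0 : R) \in `[0, 1] by rewrite in_itv /= lexx ler01.
have I1 : (1 : R) \in `[0, 1] by rewrite in_itv /= lexx ler01.
have lam01 s : 0 <= s <= 1 -> 0 <= lam s <= 1.
  move=> s01; have sI : s \in `[0, 1] by rewrite in_itv.
  case/andP: s01 => s0 s1.
  by apply/andP; split; [rewrite -[leLHS]lam0|rewrite -[leRHS]lam1]; exact: lam_mono.
have cS := smash_continuous cM clB cPsi Psi_bij Psi1 footP.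
have hS := height_smash Psi_bij Psi1 footP lam01.
pose S := smash Psi foot height lam.
exists (fun t x => S (fbar t x)).
have smash_B l x : l 0 = 0 -> B x -> smash Psi foot height l x = x.
  move=> l0 Bx; have [Bf _ Pf] := footP x.
  have hx : height x = 0 by apply/eqP; rewrite hB inE.
  by rewrite -[RHS]Pf /smash hx l0.
have S_B x : B x -> S x = x by exact: smash_B.
have hH t x : Num.min 1 (2 * height x) <= height (S (fbar t x)).
  by rewrite hS; exact: (lam_v (t, x)).
split.
- exact: (continuous_compose cfbar (cS lam clam lam01 lam1)).
- split=> [t x Bx|t x]; first by rewrite S_B// fbarB.
  rewrite -[B (S _)]in_setE -hB hS => /eqP l0; rewrite -(fbarB t) -in_setE -hB.
  by rewrite eq_le h0 andbT -l0 lam_id.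
- move=> t x; rewrite -[E x]in_setE -hE => /eqP hx.
  have [Bf _ Pf] := footP (fbar t x).
  have le1 : 1 <= lam (height (fbar t x)).
    by have := lam_v (t, x); rewrite /v /= hx min_l// mulr1 ler1n.
  have l1 : lam (height (fbar t x)) = 1.
    by apply/eqP; rewrite eq_le le1 andbT; case/andP: (lam01 _ (h01 (fbar t x))).
  by rewrite -[in RHS]Pf rPsi// /S /smash l1.
- move=> t x nBx.
  have hx : 0 < height x by rewrite lt_neqAle h0 andbT eq_sym hB notin_setE.
  have hiter k : Num.min 1 (2 ^+ k * height x) <=
      height (iter k (fun x => S (fbar t x)) x).
    elim: k => [|k IHk]; first by rewrite expr0 mul1r ge_min lexx orbT.
    rewrite iterS (le_trans _ (hH _ _))// le_min ge_min lexx /=.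
    move: IHk; rewrite exprS -mulrA; set w := 2 ^+ k * _; set z := height _.
    by rewrite /Num.min; do 2 case: ifP => ?; lra.
  have [k _ kP] := near_infty_natSinv_expn_lt (PosNum hx).
  exists k; rewrite -in_setE -hE eq_le.
  case/andP: (h01 (iter k (fun x => S (fbar t x)) x)) => _ -> /=.
  rewrite (le_trans _ (hiter k))// le_min lexx /=.
  have /= := kP k (leqnn _).
  by rewrite div1r -[ltLHS]mulr1 ltr_pdivrMl ?exprn_gt0// => /ltW.
- move=> e e0.
  have [d d0 Pd] := collar_modulus cM clB cPsi e0.
  pose th := Num.min 1 (d / 2).
  have th0 : 0 < th by rewrite lt_min ltr01 divr_gt0.
  have th1 : th <= 1 by rewrite ge_min lexx.
  have thd : th < d.
    by rewrite gt_min; apply/orP; right; rewrite ltr_pdivrMr// ltr_pMr// ltr1n.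
  (* Mixing in the identity makes the function strictly increasing, hence the smash invertible, and
     changes heights by [th * (s - lam s)], below [d] in absolute value. *)
  pose lt s := (1 - th) * lam s + th * s.
  have clt : continuous lt.
    move=> s; apply: cvgD; apply: cvgMl_tmp; [exact: clam|exact: cvg_id].
  have lt0 : lt 0 = 0 by rewrite /lt lam0 !mulr0 addr0.
  have lt1 : lt 1 = 1 by rewrite /lt lam1 !mulr1 subrK.
  have lt01 s : 0 <= s <= 1 -> 0 <= lt s <= 1.
    move=> s01; case/andP: (lam01 s s01) => l0 l1; case/andP: s01 => s0 s1.
    rewrite /lt; apply/andP; split; nra.
  have lt_mono : {in `[0, 1] &, {homo lt : s s' / s < s'}}.
    move=> s s' sI s'I ss'; have := lam_mono s s' sI s'I (ltW ss').
    by rewrite /lt; nra.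
  have [S' [SK S'K]] := smash_bijective Psi_bij Psi1 footP clt lt01 lt1 lt0 lt_mono.
  have /choice [fbar' fbarK] := fun t => bijective_inverse (fbar_bij t).
  exists (fun t x => smash Psi foot height lt (fbar t x)), (fun t y => fbar' t (S' y)).
  split.
  + exact: (continuous_compose cfbar (cS lt clt lt01 lt1)).
  + by move=> t x; rewrite SK (proj1 (fbarK t)).
  + by move=> t x; rewrite (proj2 (fbarK t)) S'K.
  + move=> t x; have [Bf hx _] := footP (fbar t x).
    apply: Pd => //; [exact: lt01|exact: lam01|].
    have := lam01 _ hx; move: hx; rewrite /lt.
    set w := height _; set z := lam w => /andP[w0 w1] /andP[z0 z1].
    rewrite (_ : _ - _ = th * (w - z)); last by lra.
    rewrite normrM (gtr0_norm th0) (le_lt_trans _ thd)// ler_piMr ?(ltW th0)//.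
    by rewrite ler_norml; apply/andP; split; lra.
  + by move=> t b Bb; rewrite S_B ?fbarB// smash_B ?fbarB.
Qed.

End NearHomeo.

(** * The attractor *)

(** Closed subsets of [A] have compact, hence closed, images. The point [x0] is the value of the
    inverse outside [B]. *)
Lemma compact_homeomorphism {X Y : topologicalType} (A : set X) (B : set Y)
    (f : X -> Y) :
  X -> hausdorff_space Y -> compact A -> {within A, continuous f} ->
  set_bij A B f -> homeomorphism A B f.
Proof.
move=> x0 hY cA cf fbij; have [fAB finj fsurj] := fbij; split=> //.
have /choice [k kP] : forall y, exists x, B y -> A x /\ f x = y.
  move=> y; have [/fsurj [x Ax <-]|nBy] := pselect (B y); first by exists x.
  by exists x0.
have kK x : A x -> k (f x) = x.
  move=> Ax; have [Akx fkx] := kP _ (fAB x Ax).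
  by apply: finj; rewrite ?inE.
exists k; split => //; apply/continuous_closedP => D cD.
apply/closed_subspaceP; exists (f @` (A `&` D)).
  apply: compact_closed => //; apply: continuous_compact.
    exact: continuous_subspaceW cf.
  exact: compact_closedI.
apply/seteqP; split=> [_ [[x [Ax Dx] <-] Bfx]|y [Dky By]] /=.
  by split => //; rewrite /preimage /from_subspace /= kK.
by have [Aky fky] := kP y By; split => //; exists (k y).
Qed.

Lemma hausdorff_dist_lt {R : realType} {M : metricType R} (A B : set M) (e : R) :
  0 < e -> (forall x, A x -> exists2 y, B y & mdist x y < e / 2) ->
  (forall y, B y -> exists2 x, A x & mdist y x < e / 2) ->
  (hausdorff_dist A B < e%:E)%E.
Proof.
move=> e0; have e2 : 0 < e / 2 by rewrite divr_gt0.
have side (C D : set M) : (forall x, C x -> exists2 y, D y & mdist x y < e / 2) ->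
    (ereal_sup [set edist_inf D x | x in C] < e%:E)%E.
  move=> CD; apply: (@le_lt_trans _ _ (e / 2)%:E); last first.
    by rewrite lte_fin ltr_pdivrMr// ltr_pMr// ltr1n.
  apply: ge_ereal_sup => _ [x /CD [y Dy xy] <-].
  apply: (@le_trans _ _ (edist (x, y))).
    by apply: ereal_inf_lbound; exists y.
  by apply: edist_fin => //=; rewrite ballEmdist.
by move=> AB BA; rewrite /hausdorff_dist gt_max !side.
Qed.

Section Attractor.
Context {R : realType} {I : topologicalType} {M : metricType R}.
Variables (B E : set M) (H : I -> M -> M) (G g : nat -> I -> M -> M).
Hypotheses (cM : compact [set: M]) (clE : closed E).
Hypothesis cH : jointly_continuous H.
Hypothesis cG : forall n, jointly_continuous (G n).
Hypothesis cg : forall i, jointly_continuous (g i).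
Hypothesis Hg : forall i t y, H t (g i.+1 t y) = g i t y.
Hypothesis Gg : forall n t y, mdist (G n t (g n t y)) y <= 2 ^- n.
Hypothesis g_orbit : forall t (x : nat -> M), (forall i, H t (x i.+1) = x i) ->
  exists y, forall i, g i t y = x i.

(** If all coordinates agree, [G n (g n y)] is within [2^-n] of both points for every [n]. *)
Lemma g_joint_inj t y y' : (forall i, g i t y = g i t y') -> y = y'.
Proof.
move=> gyy'; apply: (@mdist_le0_eq R); apply/ler_addgt0Pr => e e0; rewrite add0r.
have e20 : 0 < e / 2 by rewrite divr_gt0.
have [n _ /(_ n (leqnn _)) /=] := near_infty_natSinv_expn_lt (PosNum e20).
rewrite div1r => ne; have := Gg n t y; have := Gg n t y'; rewrite gyy'.
have := metric_triangle y (G n t (g n t y')) y'.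
by rewrite (metric_sym y (G _ _ _)) => *; lra.
Qed.

(** [Phi] prepends [H (g 0 y)] to the backward orbit of [y], and [Phi'] drops its first entry.
    Continuity comes from the closed relation between coordinates. *)
Lemma exists_extension : exists Phi Phi' : I -> M -> M,
  [/\ jointly_continuous Phi, (forall t, cancel (Phi t) (Phi' t)),
      (forall t, cancel (Phi' t) (Phi t)) &
      forall i t y, g i.+1 t (Phi t y) = g i t y].
Proof.
have /choice [Phi0 Phi0P] : forall p : I * M, exists y',
    forall i, g i.+1 p.1 y' = g i p.1 p.2.
  move=> [t y] /=.
  have [|y' y'P] := @g_orbit t (fun i => if i is j.+1 then g j t y else H t (g 0%N t y)).
    by case=> [//|i]; exact: Hg.
  by exists y' => i; exact: (y'P i.+1).
have /choice [Phi1 Phi1P] : forall p : I * M, exists y',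
    forall i, g i p.1 y' = g i.+1 p.1 p.2.
  by move=> [t y] /=; apply: (@g_orbit t (fun i => g i.+1 t y)) => i; exact: Hg.
have P0 i t y : g i.+1 t (Phi0 (t, y)) = g i t y := Phi0P (t, y) i.
have P1 i t y : g i t (Phi1 (t, y)) = g i.+1 t y := Phi1P (t, y) i.
(* Coordinate 0 is the image of coordinate 1 under [H], so the coordinates from 1 on suffice. *)
have inj_S t y y' : (forall i, g i.+1 t y = g i.+1 t y') -> y = y'.
  move=> gyy'; apply: (@g_joint_inj t) => -[|i]; last exact: gyy'.
  by rewrite -(Hg 0 t y) -(Hg 0 t y') gyy'.
exists (fun t y => Phi0 (t, y)), (fun t y => Phi1 (t, y)); split.
- apply: (@closed_graph_continuous (I * M)%type M setT
    (\bigcap_(i in [set: nat])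
      [set q : (I * M) * M | g i.+1 q.1.1 q.2 = g i q.1.1 q.1.2])) => //.
  + apply: closed_bigI => i _; apply: (closed_equalizer
      (f := fun q : (I * M) * M => g i.+1 q.1.1 q.2)
      (g := fun q => g i q.1.1 q.1.2)).
    * exact: metric_hausdorff.
    * apply: (continuous_compose
        (f := fun q : (I * M) * M => (q.1.1, q.2)) _ (@cg i.+1)).
      apply: continuous_pair; last exact: snd_continuous.
      exact: (continuous_compose fst_continuous fst_continuous).
    * exact: (continuous_compose fst_continuous (@cg i)).
  + by move=> [t y]; split => // i _; exact: P0.
  + move=> [t y] y' yy'; apply: (@inj_S t) => i.
    by rewrite P0 (yy' i).
- by move=> t y; apply: (@g_joint_inj t) => i; rewrite P1 P0.
- by move=> t y; apply: (@inj_S t) => i; rewrite P0 P1.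
- exact: P0.
Qed.

(** * Backward orbits in [E]: stable image, dependence on the parameter, periodic points *)

Variables (Phi : I -> M -> M) (m : nat).
Hypothesis gSPhi : forall i t y, g i.+1 t (Phi t y) = g i t y.
Hypothesis HE : forall t x, E x -> E (H t x).
Hypothesis H_stable : forall t,
  iter m.+1 (H t) @` E = iter m (H t) @` E.

Definition attractor t := [set y | forall i, E (g i t y)].

Lemma gPhi i t y : g i t (Phi t y) = H t (g i t y).
Proof. by rewrite -Hg gSPhi. Qed.

Lemma gPhi_iter k i t y : g i t (iter k (Phi t) y) = iter k (H t) (g i t y).
Proof. by elim: k => //= k IHk; rewrite gPhi IHk. Qed.

Lemma gD_Phi_iter k i t y : g (i + k)%N t (iter k (Phi t) y) = g i t y.
Proof. by elim: k => [|k IHk]; rewrite ?addn0// addnS /= gSPhi IHk. Qed.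

Lemma iter_gD k i t y : iter k (H t) (g (i + k)%N t y) = g i t y.
Proof. by rewrite -gPhi_iter gD_Phi_iter. Qed.

Lemma H_iter_E k t x : E x -> E (iter k (H t) x).
Proof. by move=> Ex; elim: k => //= k; exact: HE. Qed.

Lemma attractor_compact t : compact (attractor t).
Proof.
apply: (subclosed_compact _ cM) => //.
have -> : attractor t = \bigcap_(i in [set: nat]) (g i t @^-1` E).
  by apply/seteqP; split=> y Ey; [move=> i _; exact: Ey|move=> i; exact: Ey].
apply: closed_bigI => i _.
by apply: closed_preimage => //; exact: jointly_continuous_at.
Qed.

Lemma attractor_Phi t y : attractor t (Phi t y) <-> attractor t y.
Proof.
split=> Ly i; first by rewrite -gSPhi.
by rewrite gPhi; exact: HE.
Qed.

Lemma attractor_Phi_iter k t y :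
  attractor t (iter k (Phi t) y) <-> attractor t y.
Proof. by elim: k => //= k <-; exact: attractor_Phi. Qed.

(** By stabilization [H] maps [H^m(E)] onto itself, so [z] has a backward orbit inside it. This
    orbit comes from some [y0], and [Phi^n] moves its entry 0 to index [n]. *)
Lemma attractor_onto n t z : (iter m (H t) @` E) z ->
  exists2 y, attractor t y & g n t y = z.
Proof.
move=> Wz.
have /choice [pre preP] : forall x, exists x', (iter m (H t) @` E) x ->
    (iter m (H t) @` E) x' /\ H t x' = x.
  move=> x; have [Wx|nWx] := pselect ((iter m (H t) @` E) x); last by exists x.
  have := Wx; rewrite -{1}H_stable => -[w Ew wx]; exists (iter m (H t) w) => _.
  by split; [exists w|].
have Wpre i : (iter m (H t) @` E) (iter i pre z).
  by elim: i => //= i /preP[].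
have [|y0 y0P] := @g_orbit t (fun i => iter i pre z).
  by move=> i; have [_] := preP _ (Wpre i).
exists (iter n (Phi t) y0); last by rewrite -[n in g n]add0n gD_Phi_iter y0P.
apply/attractor_Phi_iter => i; rewrite y0P.
by have [w Ew <-] := Wpre i; exact: H_iter_E.
Qed.

Lemma g_attractor t : g 0%N t @` attractor t = iter m (H t) @` E.
Proof.
apply/seteqP; split=> [_ [y Ly <-]|z /(attractor_onto 0) [y Ly <-]]; last by exists y.
by rewrite -(iter_gD m) add0n; exists (g m t y) => //; exact: Ly.
Qed.

(** A point [y] for [s] is close to [G n (H_s^m w)] with [w = g (n + m) y] in [E]. Keeping [w] and
    changing the parameter to [s'], [attractor_onto] gives a point for [s'] close to
    [G n (H_s'^m w)]. The common [m] is essential to the transfer. *)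
Lemma attractor_near t e : 0 < e -> \forall s \near t,
  (forall y, attractor s y -> exists2 y', attractor t y' & mdist y y' < e) /\
  (forall y, attractor t y -> exists2 y', attractor s y' & mdist y y' < e).
Proof.
move=> e0; have e3 : 0 < e / 3%:R by rewrite divr_gt0.
have [n _ /(_ n (leqnn _)) /=] := near_infty_natSinv_expn_lt (PosNum e3).
rewrite div1r => ne.
pose K s w := G n s (iter m (H s) w).
have cK : jointly_continuous K.
  exact: (jointly_continuous_comp (@cG n) (jointly_continuous_iter m cH)).
have transfer s s' : (forall w, mdist (K s w) (K s' w) < e / 3%:R) ->
    forall y, attractor s y -> exists2 y', attractor s' y' & mdist y y' < e.
  move=> Kss' y Ly; pose w := g (n + m)%N s y.
  have [y' Ly' gy'] : exists2 y', attractor s' y' &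
      g n s' y' = iter m (H s') w.
    by apply: attractor_onto; exists w => //; exact: Ly.
  exists y' => //.
  have := Gg n s y; rewrite -(iter_gD m) => d1.
  have := Gg n s' y'; rewrite gy' => d2.
  have := Kss' w; rewrite /K => d3.
  have := metric_triangle y (G n s (iter m (H s) w)) y'.
  have := metric_triangle (G n s (iter m (H s) w)) (G n s' (iter m (H s') w)) y'.
  by rewrite (metric_sym y (G _ _ _)) => *; lra.
apply: filterS (jointly_continuous_near t cM cK e3) => s Kst.
by split; apply: transfer => // w; rewrite metric_sym.
Qed.

(** For a point of period [N], going back [i] steps equals going forward [i * N - i] steps. Entry 0
    thus determines the whole orbit, and a common period compares two points. *)
Lemma attractor_periodic_bij t : set_bij (periodic_points (attractor t) (Phi t))
  (periodic_points E (H t)) (g 0%N t).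
Proof.
split.
- move=> y [Ly [k [k0 ky]]]; split; first exact: Ly.
  by exists k; split => //; rewrite -gPhi_iter ky.
- move=> y y' /set_mem [_ [k [k0 ky]]] /set_mem [_ [k' [k'0 k'y']]] gyy'.
  have iterM l x j : iter l (Phi t) x = x -> iter (j * l) (Phi t) x = x.
    by move=> lx; elim: j => // j IHj; rewrite mulSn iterD IHj.
  have gE i x : iter (k * k') (Phi t) x = x ->
      g i t x = iter (i * (k * k') - i) (H t) (g 0%N t x).
    move=> /(iterM _ _ i) xx.
    have iN : (i <= i * (k * k'))%N by rewrite leq_pmulr// muln_gt0 k0.
    rewrite -gPhi_iter -{1}xx -{1}(subnKC iN) iterD.
    exact: (gD_Phi_iter i 0).
  apply: (@g_joint_inj t) => i.
  have yN : iter (k * k') (Phi t) y = y by rewrite mulnC; exact: iterM.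
  by rewrite (gE i y yN) (gE i y' (iterM _ _ k k'y')) gyy'.
- move=> x [Ex [k [k0 kx]]].
  have iterM j : iter (j * k) (H t) x = x.
    by elim: j => // j IHj; rewrite mulSn iterD IHj.
  (* The exponent is [-i] modulo the period; the truncated subtraction is exact because [k > 0]. *)
  have [|y yP] := @g_orbit t (fun i => iter (i * k - i) (H t) x).
    move=> i; rewrite -iterS -[in RHS](iterM 1%N) -iterD; apply: (congr1 (fun j => iter j (H t) x)).
    have : (i <= i * k)%N by rewrite leq_pmulr.
    rewrite mulSn mul1n; lia.
  exists y; last by rewrite yP.
  split; first by move=> i; rewrite yP; exact: H_iter_E.
  exists k; split => //; apply: (@g_joint_inj t) => i.
  by rewrite gPhi_iter yP -iterD addnC iterD kx.
Qed.

Lemma attractor_conjugate t (h := fun y => (fun i => g i t y) : {ptws nat -> M}) :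
  M -> homeomorphism (attractor t) (inverse_limit E (H t)) h /\
  forall y, h (Phi t y) = natural_extension (H t) (h y).
Proof.
move=> x0; split; last first.
  by move=> y; apply/funext => -[|i] /=; [rewrite -gPhi|exact: gSPhi].
apply: compact_homeomorphism => //.
- by apply: hausdorff_product => _; exact: metric_hausdorff.
- exact: attractor_compact.
- apply: continuous_subspaceT => y; apply/pointwise_cvgP => i.
  exact: (jointly_continuous_at (@cg i)).
split.
- by move=> y Ly i; split; [exact: Ly|exact: Hg].
- move=> y y' _ _ hyy'; apply: (@g_joint_inj t) => i.
  exact: (congr1 (fun x => x i) hyy').
- move=> x xP; have [|y yP] := @g_orbit t x; first by move=> i; have [] := xP i.
  exists y; last by apply/funext.
  by move=> i; rewrite yP; have [] := xP i.
Qed.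

(** * Boundary behaviour and omega-limit sets *)

Hypothesis HB : forall t, H t @` B = B.
Hypothesis HBinv : forall t x, B (H t x) -> B x.
Hypothesis gB : forall i t b, B b -> g i t (iter i (H t) b) = b.
Hypothesis H_reach : forall t x, ~ B x -> exists L, E (iter L (H t) x).

(** On [B] the map [g i] undoes [H^i], so [Phi b] and [H b] have the same coordinates. *)
Lemma Phi_B t b : B b -> Phi t b = H t b.
Proof.
move=> Bb; apply: (@g_joint_inj t) => -[|i].
  by rewrite gPhi (gB 0 t Bb) (gB 0 t (iter_stable 1 (HB t) Bb)).
have [z Bz zb] := iter_stable_onto i (HB t) Bb.
by rewrite gSPhi -zb gB// -iterS gB.
Qed.

(** If [g 0 y] is in [B], so is its backward orbit by [HBinv]; then
    [g i (g 0 y) = g i (H^i (g i y)) = g i y] for every [i]. *)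
Lemma g0_B t y : B (g 0%N t y) -> B y.
Proof.
move=> Bg0; suff <- : g 0%N t y = y by [].
have HBinv_iter k x : B (iter k (H t) x) -> B x.
  by elim: k => // k IHk /= /HBinv /IHk.
apply: (@g_joint_inj t) => i.
by rewrite -{1}(iter_gD i 0) add0n gB//; apply: (HBinv_iter i); rewrite (iter_gD i 0).
Qed.

(** If [g 0 x] enters [E] after [L] steps, coordinate [i] of [Phi^j x] lies in [E] for all
    [j >= i + L]. As [E] is closed, this passes to cluster points. *)
Lemma attractor_omega t x : ~ B x -> omega_limit x (Phi t) `<=` attractor t.
Proof.
move=> nBx z zx i.
have [L EL] := @H_reach t (g 0%N t x) (fun Bg => nBx (g0_B Bg)).
apply: clE => U /(@jointly_continuous_at I M M (g i) t (@cg i) z) nU.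
have xi : ((fun j => iter j (Phi t) x) @ \oo)
    ((fun j => iter j (Phi t) x) @` [set j | (i + L <= j)%N]).
  by exists (i + L)%N => // j /= ij; exists j.
have [_ [[j /= ij <-] Uj]] := zx _ _ xi nU.
exists (g i t (iter j (Phi t) x)); split => //.
have -> : j = (i + (j - i))%N by lia.
rewrite iterD -{1}[i]add0n gD_Phi_iter gPhi_iter.
have -> : (j - i = (j - i - L) + L)%N by lia.
by rewrite iterD; exact: H_iter_E.
Qed.

End Attractor.

(** * From the unwrapping of the family to the homeomorphisms and their attractors *)

Unset Implicit Arguments.
Set Strict Implicit.

Theorem theorem3p1 (R : realType) (n : nat) (M : metricType R)
  (M_compact : compact [set: M])
  (M_manifold : manifold_with_boundary R n M)
  (bM_nonempty : manifold_boundary R n M !=set0)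
  (E : set M) (Psi : M * R -> M) (r : M -> M)
  (E_retract : boundary_retract_map n E Psi)
  (r_retraction : associated_retraction n Psi r)
  (I : metricType R) (I_compact : compact [set: I])
  (f : I -> M -> M)
  (f_family : continuous_family_C E E f)
  (f_unwraps : family_unwraps n E r f)
  (m : nat) (m_gt0 : (0 < m)%N)
  (f_stabilizes : forall t, stabilizes_at E (f t) m)
  (eps : R) (eps_gt0 : 0 < eps) :
  exists (Phi : I -> M -> M) (Lambda : I -> set M) (g : I -> M -> M),
    continuous_family_H [set: M] [set: M] Phi /\
    (* (a) *)
    (forall t,
      [/\ compact (Lambda t),
          Phi t @` Lambda t = Lambda t,
          conjugate_on (Lambda t) (Phi t)
            (inverse_limit E (f t)) (natural_extension (f t)),
          (forall x, ~ manifold_boundary R n M x ->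
            omega_limit x (Phi t) `<=` Lambda t) &
          periodic_on (manifold_boundary R n M) (Phi t)]) /\
    (* (b) *)
    continuous_family_C [set: M] [set: M] g /\
    (forall t,
      [/\ (uniform_dist [set: M] (g t) id < eps%:E)%E,
          g t @` Lambda t = iter m (f t) @` E &
          forall x, Lambda t x -> f t (g t x) = g t (Phi t x)]) /\
    (* (c) *)
    (forall t, set_bij (periodic_points (Lambda t) (Phi t))
                       (periodic_points E (f t)) (g t)) /\
    (* (d) *)
    (forall (t : I) (e : R), 0 < e ->
      \forall s \near t, (hausdorff_dist (Lambda s) (Lambda t) < e%:E)%E).
Proof.
have [cPsi [_ Psi_bij _] Psi0 Psi1] := E_retract.
case: cPsi => cPsi _.
pose B := manifold_boundary R n M.
have clB : closed B := @manifold_boundary_closed R n M.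
have [f_cont _] := f_family.
have fE t x : E x -> E (f t x) by have [_] := f_cont t; exact.
have [fbar [[fbar_homeo fbar_param] fbar_unwrap]] := f_unwraps.
have fbar_cont t : continuous (fbar t).
  by have [cf _ _] := fbar_homeo t; exact: continuous_withinT.
have cfbar : jointly_continuous fbar by exact: parameter_continuous_joint.
have fbar_bij t : set_bij setT setT (fbar t) by have [] := fbar_homeo t.
have /choice [fbar' fbarK] := fun t => bijective_inverse (fbar_bij t).
have fbarK1 t : cancel (fbar t) (fbar' t) by case: (fbarK t).
have fbarK2 t : cancel (fbar' t) (fbar t) by case: (fbarK t).
have cfbar' : jointly_continuous fbar'.
  exact: (jointly_continuous_inverse M_compact (@metric_hausdorff _ M) cfbar).
(* Homeomorphisms of [M] preserve the manifold interior, hence its complement. *)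
have fbarB t x : B (fbar t x) <-> B x.
  have cF := jointly_continuous_at (t := t) cfbar.
  have cF' := jointly_continuous_at (t := t) cfbar'.
  split; apply: contra_not => Ix.
    exact: (manifold_interior_homeo cF cF' (fbarK1 t) (fbarK2 t)).
  by rewrite -(fbarK1 t x); exact: (manifold_interior_homeo cF' cF (fbarK2 t) (fbarK1 t)).
have [H [cH [Hfbar HBinv] Hr H_reach H_near]] := smashed_unwrapping I_compact
  M_compact clB cPsi Psi_bij Psi0 Psi1 r_retraction cfbar fbar_bij fbarB.
have Hf t x : E x -> H t x = f t x.
  by move=> Ex; rewrite Hr//; have [_ + _] := fbar_unwrap t; exact.
have HE t x : E x -> E (H t x) by move=> Ex; rewrite Hf//; exact: fE.
have Hf_iter k t x : E x -> iter k (H t) x = iter k (f t) x.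
  by move=> Ex; elim: k => //= k <-; rewrite Hf//; exact: (H_iter_E HE).
have Hf_image k t : iter k (H t) @` E = iter k (f t) @` E.
  by apply/seteqP; split=> _ [x Ex <-]; exists x; rewrite ?Hf_iter.
have HB t : H t @` B = B.
  apply/seteqP; split=> [_ [x Bx <-]|x Bx]; first by rewrite Hfbar// fbarB.
  have Bx' : B (fbar' t x) by rewrite -(fbarB t) fbarK2.
  by exists (fbar' t x) => //; rewrite Hfbar// fbarK2.
have clE : closed E.
  have cB : compact B by apply: (subclosed_compact clB M_compact).
  rewrite -Psi1; apply: compact_closed; first exact: metric_hausdorff.
  apply: continuous_compact; last first.
    by apply: compact_setX => //; exact: compact_set1.
  by apply: continuous_subspaceW cPsi => -[eta s] [/= ? ->]; split => //=;
    rewrite in_itv /= ler01 lexx.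
(* Half of [eps] leaves room for a strict bound on the supremum. *)
have eps2 : 0 < eps / 2 by rewrite divr_gt0.
have [G [g [cGg Hg g_id Gg [g_orbit gB]]]] :=
  brown_near_homeomorphism I_compact M_compact cH HB H_near eps2.
have cG k := proj1 (cGg k); have cg k := proj2 (cGg k).
have [Phi [Phi' [cPhi PhiK Phi'K gSPhi]]] := exists_extension M_compact cg Hg Gg g_orbit.
have cPhi' : jointly_continuous Phi'.
  exact: (jointly_continuous_inverse M_compact (@metric_hausdorff _ M) cPhi).
have H_stable t : iter m.+1 (H t) @` E = iter m (H t) @` E.
  by rewrite !Hf_image; exact: f_stabilizes.
have gPhi' := gPhi Hg gSPhi.
exists Phi, (attractor E g), (g 0%N); split.
  split; last exact: jointly_continuous_parameter.
  by move=> t; apply: (homeomorphismT (f' := Phi' t)) => //; exact: jointly_continuous_at.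
split.
  move=> t; split.
  - exact: attractor_compact.
  - have LPhi := attractor_Phi Hg gSPhi HE t.
    apply/seteqP; split=> [_ [y Ly <-]|y Ly]; first exact/LPhi.
    by exists (Phi' t y); rewrite ?Phi'K//; apply/LPhi; rewrite Phi'K.
  - have [x0 _] := bM_nonempty.
    have [homeo comm] := attractor_conjugate M_compact clE cg Hg Gg g_orbit gSPhi t x0.
    exists (fun y => (fun i => g i t y) : {ptws nat -> M}); split.
      (* [H t] and [f t] agree on [E], so their backward orbits in [E] coincide. *)
      suff <- : inverse_limit E (H t) = inverse_limit E (f t) by [].
      apply/seteqP; split=> x xP i; have [Ex xi] := xP i; have [Ex' _] := xP i.+1.
        by rewrite -Hf.
      by rewrite Hf.
    move=> y Ly; rewrite [LHS]comm; apply/funext => -[|i] //=.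
    by rewrite Hf//; exact: (Ly 0%N).
  - by move=> x; apply: (attractor_omega clE cg Hg Gg gSPhi HE HBinv gB H_reach).
  - have [_ _ [k [k0 fk]]] := fbar_unwrap t.
    exists k; split => // x Bx; rewrite -[RHS](fk x Bx).
    (* On the boundary [Phi t] is the unwrapping itself and inherits its period. *)
    have Phi_fbar y : B y -> Phi t y = fbar t y.
      by move=> By; rewrite (Phi_B Hg Gg gSPhi HB gB)// Hfbar.
    suff: B (iter k (fbar t) x) /\ iter k (Phi t) x = iter k (fbar t) x by case.
    elim: k {k0 fk} => //= k [Bk ->]; split; first exact/fbarB.
    exact: Phi_fbar.
split.
  split; last exact: jointly_continuous_parameter.
  by move=> t; split => //; apply: continuous_subspaceT; exact: jointly_continuous_at.
split.
  move=> t; split.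
  - by apply: uniform_dist_lt.
  - by rewrite -Hf_image; exact: g_attractor.
  - by move=> x Lx; rewrite gPhi' Hf//; exact: (Lx 0%N).
split.
  move=> t.
  suff <- : periodic_points E (H t) = periodic_points E (f t).
    exact: attractor_periodic_bij.
  apply/seteqP; split=> x [Ex [k [k0 kx]]]; split => //; exists k.
    by rewrite -Hf_iter.
  by rewrite Hf_iter.
move=> t e e0; have e2 : 0 < e / 2 by rewrite divr_gt0.
have := attractor_near M_compact cH cG Hg Gg g_orbit gSPhi HE H_stable t e2.
apply: filterS => s [st ts].
exact: hausdorff_dist_lt.
Qed.
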